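(* Let $M$ be an Anderson $A$-motive over $R$ and let $J$ be a nonzero ideal of $R$. The natural maps $$u_M^{(J)}:U_M^{(J),\dagger}\to U_M^{(J)}\quad\text{and}\quad h_M^{(J)}:H_M^{(J),\dagger}\to H_M^{(J)}$$ are both isomorphisms.
   Context: **Setting.** $\mathbb F$ is a finite field with $q$ elements, $C$ is a smooth projective curve over $\mathbb F$ with function field $K$, $\infty$ is a closed point of $C$, $A=\mathcal O_C(C\setminus\{\infty\})$ (so $K=\mathrm{Frac}(A)$), $L$ is a finite extension of $K$ and $R$ is the integral closure of $A$ in $L$. $K_\infty$ is the completion of $K$ at $\infty$ and $L_\infty=L\otimes_K K_\infty$, a finite product of finite extensions of $K_\infty$. $|\cdot|$ denotes the $\infty$-adic norm on $K_\infty$ and on $L_\infty$ (maximum over the factors of the unique extension of the absolute value). Unlabeled tensor products are over $\mathbb F$. **Motives.** $R[\tau]$ is the Ore polynomial ring with $\tau r=r^q\tau$ for $r\in R$; in $A\otimes R[\tau]$, $\tau$ commutes with $A$. An Anderson $A$-motive over $R$ is a left $A\otimes R[\tau]$-module $M$ that is finitely generated projective over $R[\tau]$ and such that for all $a\in A$, multiplication by $a\otimes 1-1\otimes a$ is nilpotent on $\mathrm{Lie}(M):=M/R[\tau]\tau M$. For a left $R[\tau]$-module $X$ put $E_M(X)=\mathrm{Hom}_{R[\tau]}(M,X)$; for an $R$-module $X$ put $\mathrm{Lie}_M(X)=\mathrm{Hom}_R(\mathrm{Lie}(M),X)$. They are $A$-modules via $(af)(m)=f(am)$. If $X$ also has a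 commuting right action of $\tau$, they become $A[\tau]$-modules via $(f\tau)(m)=f(m)\tau$. **Series.** $L_\infty[\![\tau]\!]$ is the ring of noncommutative power series with $\tau a=a^q\tau$. For $r>0$, $L_\infty\langle\tau;r\rangle=\{\sum_i a_i\tau^i: a_i\in L_\infty,\ |a_i|r^{q^i}\to0\}$; $L_\infty\langle\tau\rangle=L_\infty\langle\tau;1\rangle$; $L_\infty\langle\tau\rangle^\dagger=\bigcup_{r>1}L_\infty\langle\tau;r\rangle\subset L_\infty\langle\tau\rangle$. These have a left action of $R[\tau]$ and a right action of $\tau$ by multiplication. $J[\tau]$ is the set of polynomials with (left) coefficients in $J$. **Exponential.** Choose a basis $(m_i)$ of the free left $L[\tau]$-module $M_L=L[\tau]\otimes_{R[\tau]}M$, of rank $d_0$. For any left $L[\tau]$-module $X$, $f\mapsto (f(m_i))_i$ identifies $E_M(X)\simeq X^{d_0}$, and similarly $\mathrm{Lie}_M(X)\simeq X^{d_0}$ (using the classes of the $m_i$ in $L\otimes_R\mathrm{Lie}(M)$). Let $\phi(a)\in M_{d_0}(L[\tau])$ be the matrix of $a\in A$ ($a m_i=\sum_j\phi(a)_{ij}m_j$) and $\partial\phi(a)\in M_{d_0}(L)$ its constant term. Let $\exp=\mathrm{Id}+\sum_{i\ge1}e_i\tau^i\in M_{d_0}(L)[\![\tau]\!]$ be the unique series with $\exp\cdot\partial\phi(a)=\phi(a)\cdot\exp$ for all $a\in A$. Left multiplication by it defines $\exp_M:\mathrm{Lie}_M(L_\infty[\![\tau]\!])\to E_M(L_\infty[\![\tau]\!])$,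 independent of the basis, which maps $\mathrm{Lie}_M(L_\infty\langle\tau\rangle)$ to $E_M(L_\infty\langle\tau\rangle)$ and $\mathrm{Lie}_M(L_\infty\langle\tau\rangle^\dagger)$ to $E_M(L_\infty\langle\tau\rangle^\dagger)$. **Units and class modules.** $U_M^{(J)}$ and $H_M^{(J)}$ are the kernel and cokernel of the $A[\tau]$-linear map $\mathrm{Lie}_M(L_\infty\langle\tau\rangle)\to E_M(L_\infty\langle\tau\rangle)/E_M(J[\tau])$ induced by $\exp_M$. $U_M^{(J),\dagger}$ and $H_M^{(J),\dagger}$ are the kernel and cokernel of the map $\mathrm{Lie}_M(L_\infty\langle\tau\rangle^\dagger)\to E_M(L_\infty\langle\tau\rangle^\dagger)/E_M(J[\tau])$ induced by $\exp_M$. The $A[\tau]$-linear maps $u_M^{(J)}$, $h_M^{(J)}$ are induced by the inclusion $L_\infty\langle\tau\rangle^\dagger\subset L_\infty\langle\tau\rangle$. *)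

(* Defs.v *)
(* World: MathComp + MathComp-Analysis. *)
From HB Require Import structures.
From mathcomp Require Import all_boot all_order all_algebra all_field.
From mathcomp Require Import boolp classical_sets reals topology normedtype sequences exp.
Set Implicit Arguments.
Unset Strict Implicit.
Unset Printing Implicit Defensive.
Import Order.TTheory GRing.Theory Num.Theory.
Import numFieldNormedType.Exports.
Local Open Scope ring_scope.
Local Open Scope quotient_scope.
Local Open Scope classical_set_scope.

Section Quot.
Variables (S : nzRingType) (V : lmodType S) (N : submodClosed V).
Definition quot_rel (x y : V) : bool := x - y \in N.
Lemma submodN x : (- x \in N) = (x \in N).
Proof.
have h y : y \in N -> - y \in N by move=> yN; rewrite -scaleN1r rpredZ.
by apply/idP/idP=> /h; rewrite ?opprK.
Qed.
Lemma quot_rel_equiv : equiv_class_of quot_rel.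
Proof.
split=> [x|x y|y x z]; rewrite /quot_rel.
- by rewrite subrr rpred0.
- by rewrite -opprB submodN.
- by move=> xy yz; rewrite -(subrKA y) rpredD.
Qed.
Canonical quot_equiv := EquivRelPack quot_rel_equiv.
Definition quot := {eq_quot quot_equiv}.
HB.instance Definition _ := EqQuotient.on quot.
HB.instance Definition _ := Choice.on quot.
Definition qpi (x : V) : quot := \pi_quot x.
Lemma qpiP x y : (qpi x = qpi y) <-> (x - y \in N).
Proof. by split=> [/eqmodP|h]; [|apply/eqmodP]. Qed.
Lemma qreprK (x : quot) : qpi (repr x) = x.
Proof. exact: reprK. Qed.
Lemma qpiW (P : quot -> Prop) : (forall x, P (qpi x)) -> forall x, P x.
Proof. by move=> h x; rewrite -(qreprK x). Qed.
Definition qadd (x y : quot) := qpi (repr x + repr y).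
Definition qopp (x : quot) := qpi (- repr x).
Definition qscale a (x : quot) := qpi (a *: repr x).
Lemma qrepr x : repr (qpi x) - x \in N.
Proof. by apply/qpiP; rewrite qreprK. Qed.
Lemma qaddE x y : qadd (qpi x) (qpi y) = qpi (x + y).
Proof. by apply/qpiP; rewrite opprD addrACA rpredD ?qrepr. Qed.
Lemma qoppE x : qopp (qpi x) = qpi (- x).
Proof. by apply/qpiP; rewrite -opprD submodN qrepr. Qed.
Lemma qscaleE a x : qscale a (qpi x) = qpi (a *: x).
Proof. by apply/qpiP; rewrite -scalerBr rpredZ ?qrepr. Qed.
Lemma qaddA : associative qadd.
Proof. by elim/qpiW=> x; elim/qpiW=> y; elim/qpiW=> z; rewrite !qaddE addrA. Qed.
Lemma qaddC : commutative qadd.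
Proof. by elim/qpiW=> x; elim/qpiW=> y; rewrite !qaddE addrC. Qed.
Lemma qadd0 : left_id (qpi 0) qadd.
Proof. by elim/qpiW=> x; rewrite !qaddE add0r. Qed.
Lemma qaddN : left_inverse (qpi 0) qopp qadd.
Proof. by elim/qpiW=> x; rewrite qoppE !qaddE addNr. Qed.
HB.instance Definition _ := GRing.isZmodule.Build quot qaddA qaddC qadd0 qaddN.
Lemma qscaleA a b x : qscale a (qscale b x) = qscale (a * b) x.
Proof. by elim/qpiW: x => x; rewrite !qscaleE scalerA. Qed.
Lemma qscale1 : left_id 1 qscale.
Proof. by elim/qpiW=> x; rewrite !qscaleE scale1r. Qed.
Lemma qscaleDr : right_distributive qscale +%R.
Proof. by move=> a; elim/qpiW=> x; elim/qpiW=> y; rewrite /= -[_ + _]/(qadd _ _) -[qscale a _ + _]/(qadd _ _) !(qscaleE, qaddE) scalerDr. Qed.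
Lemma qscaleDl x : {morph qscale^~ x : a b / a + b}.
Proof. by elim/qpiW: x => x a b; rewrite -[_ + qscale _ _]/(qadd _ _) !(qscaleE, qaddE) scalerDl. Qed.
HB.instance Definition _ := GRing.Zmodule_isLmodule.Build S quot qscaleA qscale1 qscaleDr qscaleDl.
Lemma qpi_is_linear : linear qpi.
Proof. by move=> a x y; rewrite -qaddE -qscaleE. Qed.
HB.instance Definition _ := GRing.isLinear.Build S V quot _ qpi qpi_is_linear.
End Quot.


(* The tensor product T (x)_S V along h : S -> T, as finite formal sums of
   pairs (t, v), two sums being identified when every balanced biadditive map
   takes the same value on them. *)
Section Tensor.
Variables (S T : nzRingType) (h : {rmorphism S -> T}) (V : lmodType S).
Definition balanced (G : zmodType) (b : T -> V -> G) : Prop :=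
  [/\ forall t t' v, b (t + t') v = b t v + b t' v,
      forall t v v', b t (v + v') = b t v + b t v'
    & forall t s v, b (t * h s) v = b t (s *: v)].
Definition fsum (G : zmodType) (b : T -> V -> G) (x : seq (T * V)) : G :=
  \sum_(p <- x) b p.1 p.2.
Definition tens_rel (x y : seq (T * V)) : bool :=
  `[< forall (G : zmodType) (b : T -> V -> G), balanced b -> fsum b x = fsum b y >].
Lemma tens_rel_equiv : equiv_class_of tens_rel.
Proof.
split=> [x|x y|y x z]; first by apply/asboolP.
- by apply: asbool_equiv_eq; split=> e G b hb; rewrite e.
- by move=> /asboolP xy /asboolP yz; apply/asboolP=> G b hb; rewrite xy // yz.
Qed.
Canonical tens_equiv := EquivRelPack tens_rel_equiv.
Definition tens := {eq_quot tens_equiv}.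
HB.instance Definition _ := EqQuotient.on tens.
HB.instance Definition _ := Choice.on tens.
Definition tpi x : tens := \pi_tens x.
(* The additive map T (x)_S V -> G induced by a balanced map b. *)
Definition tlift (G : zmodType) (b : T -> V -> G) (x : tens) : G := fsum b (repr x).
Lemma tpiP x y : tpi x = tpi y <->
  (forall (G : zmodType) (b : T -> V -> G), balanced b -> fsum b x = fsum b y).
Proof. by split=> [/eqmodP/asboolP|e]; [|apply/eqmodP/asboolP]. Qed.
Lemma treprK (x : tens) : tpi (repr x) = x.
Proof. exact: reprK. Qed.
Lemma tliftE (G : zmodType) (b : T -> V -> G) x : balanced b -> tlift b (tpi x) = fsum b x.
Proof. by move=> hb; have /tpiP := treprK (tpi x); apply. Qed.
Lemma tpiW (P : tens -> Prop) : (forall x, P (tpi x)) -> forall x, P x.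
Proof. by move=> e x; rewrite -(treprK x). Qed.
Definition tadd (x y : tens) := tpi (repr x ++ repr y).
Definition tscale (t : T) (x : tens) := tpi [seq (t * p.1, p.2) | p <- repr x].
Definition topp := tscale (-1).
Lemma fsum_cat (G : zmodType) (b : T -> V -> G) x y : fsum b (x ++ y) = fsum b x + fsum b y.
Proof. by rewrite /fsum big_cat. Qed.
Lemma balancedZ (G : zmodType) (b : T -> V -> G) t : balanced b -> balanced (fun t' => b (t * t')).
Proof. by case=> b1 b2 b3; split=> *; rewrite ?mulrDr ?mulrA //. Qed.
Lemma fsum_scale (G : zmodType) (b : T -> V -> G) t x :
  fsum b [seq (t * p.1, p.2) | p <- x] = fsum (fun t' => b (t * t')) x.
Proof. by rewrite /fsum big_map. Qed.
Lemma taddE x y : tadd (tpi x) (tpi y) = tpi (x ++ y).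
Proof. by apply/tpiP=> G b hb; rewrite !fsum_cat -!/(tlift b _) !tliftE. Qed.
Lemma tscaleE t x : tscale t (tpi x) = tpi [seq (t * p.1, p.2) | p <- x].
Proof.
apply/tpiP=> G b hb; rewrite !fsum_scale -/(tlift _ _) tliftE //.
exact: balancedZ.
Qed.
Lemma taddA : associative tadd.
Proof. by elim/tpiW=> x; elim/tpiW=> y; elim/tpiW=> z; rewrite !taddE catA. Qed.
Lemma taddC : commutative tadd.
Proof.
by elim/tpiW=> x; elim/tpiW=> y; rewrite !taddE; apply/tpiP=> G b hb; rewrite !fsum_cat addrC.
Qed.
Lemma tadd0 : left_id (tpi [::]) tadd.
Proof. by elim/tpiW=> x; rewrite taddE. Qed.
Lemma taddN : left_inverse (tpi [::]) topp tadd.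
Proof.
elim/tpiW=> x; rewrite /topp tscaleE taddE; apply/tpiP=> G b [b1 b2 b3].
rewrite fsum_cat fsum_scale /fsum big_nil -big_split big1 //= => p _.
have b0 v : b 0 v = 0 by apply: (@addrI _ (b 0 v)); rewrite -b1 !addr0.
by rewrite -b1 mulN1r addNr b0.
Qed.
HB.instance Definition _ := GRing.isZmodule.Build tens taddA taddC tadd0 taddN.
Lemma tscaleA a b x : tscale a (tscale b x) = tscale (a * b) x.
Proof.
elim/tpiW: x => x; rewrite !tscaleE -map_comp; congr tpi.
by apply: eq_map => p /=; rewrite mulrA.
Qed.
Lemma tscale1 : left_id 1 tscale.
Proof.
elim/tpiW=> x; rewrite !tscaleE; congr tpi.
by rewrite -[RHS]map_id; apply: eq_map => -[t v] /=; rewrite mul1r.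
Qed.
Lemma tscaleDr : right_distributive tscale +%R.
Proof.
move=> a; elim/tpiW=> x; elim/tpiW=> y.
by rewrite -[_ + tpi y]/(tadd _ _) -[tscale a _ + _]/(tadd _ _) !(tscaleE, taddE) map_cat.
Qed.
Lemma tscaleDl x : {morph tscale^~ x : a b / a + b}.
Proof.
elim/tpiW: x => x a b; rewrite -[_ + tscale _ _]/(tadd _ _) !(tscaleE, taddE).
apply/tpiP=> G f [f1 f2 f3]; rewrite fsum_cat !fsum_scale /fsum -big_split.
by apply: eq_bigr => p _; rewrite mulrDl f1.
Qed.
HB.instance Definition _ := GRing.Zmodule_isLmodule.Build T tens tscaleA tscale1 tscaleDr tscaleDl.
Definition tpure t v : tens := tpi [:: (t, v)].
Lemma tlift_pure (G : zmodType) (b : T -> V -> G) t v : balanced b -> tlift b (tpure t v) = b t v.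
Proof. by move=> hb; rewrite tliftE // /fsum big_seq1. Qed.
Lemma tliftD (G : zmodType) (b : T -> V -> G) x y : balanced b ->
  tlift b (x + y) = tlift b x + tlift b y.
Proof.
move=> hb; elim/tpiW: x => x; elim/tpiW: y => y.
by rewrite -[_ + tpi y]/(tadd _ _) taddE !tliftE // fsum_cat.
Qed.
Lemma tens_ind (P : tens -> Prop) : P 0 -> (forall t v x, P x -> P (tpure t v + x)) ->
  forall x, P x.
Proof.
move=> P0 PS; elim/tpiW; elim=> [//|[t v] s ih].
by have := PS t v _ ih; rewrite -[_ + tpi s]/(tadd _ _) taddE.
Qed.
Lemma tpure_balanced : balanced tpure.
Proof.
split=> *; rewrite -?[_ + tpure _ _]/(tadd _ _) ?taddE; apply/tpiP=> G b [b1 b2 b3];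
  by rewrite /fsum !(big_cat, big_seq1) /=.
Qed.
Lemma tscale_pure a t v : a *: tpure t v = tpure (a * t) v.
Proof. by rewrite -[_ *: _]/(tscale _ _) tscaleE. Qed.
End Tensor.

Section Frobenius.
Variables (F : finFieldType) (B : comNzRingType) (i : {rmorphism F -> B}).

Lemma qpnat k : [pchar B].-nat (#|F| ^ k)%N.
Proof.
have [p p_pr pF] := finPcharP F.
rewrite (card_pprimeChar pF) -expnM pnatX pnatE // (rmorph_pchar i pF).
by [].
Qed.

Lemma qexpD k (x y : B) :
  (x + y) ^+ (#|F| ^ k) = x ^+ (#|F| ^ k) + y ^+ (#|F| ^ k).
Proof. exact/exprDn_pchar/qpnat. Qed.

Lemma qexp0 k : 0 ^+ (#|F| ^ k) = 0 :> B.
Proof. by rewrite expr0n expn_eq0 -leqn0 leqNgt (ltnW (finNzRing_gt1 F)). Qed.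

Lemma qexpN k (x : B) : (- x) ^+ (#|F| ^ k) = - x ^+ (#|F| ^ k).
Proof. by apply/(addIr (x ^+ (#|F| ^ k))); rewrite -qexpD !addNr qexp0. Qed.

Lemma qexp_sum k (I : Type) (r : seq I) (P : pred I) (f : I -> B) :
  (\sum_(j <- r | P j) f j) ^+ (#|F| ^ k) = \sum_(j <- r | P j) f j ^+ (#|F| ^ k).
Proof. exact: (big_morph (fun x : B => x ^+ (#|F| ^ k)) (qexpD k) (qexp0 k)). Qed.

End Frobenius.

(* B[[tau]], with tau * b = b ^+ q * tau.  The argument i only records that B is
   an F-algebra, so that b |-> b ^+ q is a ring morphism. *)
Record tseries (F : finFieldType) (B : comNzRingType) (i : {rmorphism F -> B}) :=
  TSeries { tcoef : nat -> B }.

Section TwistedSeries.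
Variables (F : finFieldType) (B : comNzRingType) (i : {rmorphism F -> B}).
Local Notation q := #|F|.
Local Notation S := (tseries i).
HB.instance Definition _ := gen_eqMixin S.
HB.instance Definition _ := gen_choiceMixin S.

Lemma tseriesP (f g : S) : (forall n, tcoef f n = tcoef g n) <-> f = g.
Proof. by split=> [|->//]; case: f g => [f] [g] /= /funext ->. Qed.

Definition tsadd (f g : S) : S := TSeries i (fun n => tcoef f n + tcoef g n).
Definition tsopp (f : S) : S := TSeries i (fun n => - tcoef f n).
Definition tsmul (f g : S) : S :=
  TSeries i (fun n => \sum_(k < n.+1) tcoef f k * tcoef g (n - k) ^+ (q ^ k)).
Definition tsconst (b : B) : S := TSeries i (fun n => if n is 0%N then b else 0).

Lemma tsaddA : associative tsadd.
Proof. by move=> f g h; apply/tseriesP=> n; rewrite /= addrA. Qed.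
Lemma tsaddC : commutative tsadd.
Proof. by move=> f g; apply/tseriesP=> n; rewrite /= addrC. Qed.
Lemma tsadd0 : left_id (tsconst 0) tsadd.
Proof. by move=> f; apply/tseriesP=> -[|n]; rewrite /= add0r. Qed.
Lemma tsaddN : left_inverse (tsconst 0) tsopp tsadd.
Proof. by move=> f; apply/tseriesP=> -[|n]; rewrite /= addNr. Qed.
HB.instance Definition _ := GRing.isZmodule.Build S tsaddA tsaddC tsadd0 tsaddN.

Lemma tsmulA : associative tsmul.
Proof.
move=> f g h; apply/tseriesP=> n /=.
pose c j k := tcoef f j * tcoef g k ^+ (q ^ j) * tcoef h (n - (k + j)) ^+ (q ^ (k + j)).
transitivity (\sum_(0 <= j < n.+1) \sum_(0 <= k < n.+1 - j) c j k).
  rewrite big_mkord; apply: eq_bigr => j _.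
  rewrite (qexp_sum i) big_distrr big_mkord subSn ?leq_ord //=.
  apply: eq_bigr => k _; rewrite exprMn -exprM -expnD mulrA /c.
  by rewrite -subnDA [(k + j)%N]addnC.
symmetry; transitivity (\sum_(0 <= k < n.+1) \sum_(0 <= j < n.+1 | (j <= k)%N) c j (k - j)%N).
  rewrite [RHS]big_mkord; apply: eq_bigr => k _.
  rewrite big_mkord big_ord_narrow_leq ?leq_ord //= big_distrl /=.
  by move=> _; apply: eq_bigr => j _; rewrite /c subnK // leq_ord.
rewrite (exchange_big_dep predT) //=; apply: eq_big_nat => j /andP[_ jn].
transitivity (\sum_(j <= k < n.+1) c j (k - j)%N); first by rewrite (big_nat_widenl j 0).
by rewrite -{1}[j]add0n big_addn; apply: eq_bigr => k _; rewrite addnK.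
Qed.
Lemma tsmul1s : left_id (tsconst 1) tsmul.
Proof.
move=> f; apply/tseriesP=> n /=.
by rewrite big_ord_recl /= subn0 mul1r big1 ?addr0 // => k _; rewrite mul0r.
Qed.
Lemma tsmuls1 : right_id (tsconst 1) tsmul.
Proof.
move=> f; apply/tseriesP=> n /=.
rewrite big_ord_recr /= subnn expr1n mulr1 big1 ?add0r // => k _.
by have := ltn_ord k; rewrite -subn_gt0; case: (n - k)%N => // m _; rewrite qexp0 mulr0.
Qed.
Lemma tsmulDl : left_distributive tsmul +%R.
Proof.
move=> f g h; apply/tseriesP=> n /=; rewrite -big_split.
by apply: eq_bigr => k _; rewrite mulrDl.
Qed.
Lemma tsmulDr : right_distributive tsmul +%R.
Proof.
move=> f g h; apply/tseriesP=> n /=; rewrite -big_split.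
by apply: eq_bigr => k _; rewrite (qexpD i) mulrDr.
Qed.
Lemma ts1_neq0 : tsconst 1 != 0.
Proof.
by apply/eqP=> /tseriesP/(_ 0%N)/= /eqP; rewrite oner_eq0.
Qed.
HB.instance Definition _ := GRing.Zmodule_isNzRing.Build S
  tsmulA tsmul1s tsmuls1 tsmulDl tsmulDr ts1_neq0.

Definition tstau : S := TSeries i (fun n => (n == 1%N)%:R).

Lemma tcoef0 n : tcoef (0 : S) n = 0. Proof. by case: n. Qed.
Lemma tcoefB (f g : S) n : tcoef (f - g) n = tcoef f n - tcoef g n.
Proof. by []. Qed.
Lemma tcoefD (f g : S) n : tcoef (f + g) n = tcoef f n + tcoef g n.
Proof. by []. Qed.
Lemma tcoefM (f g : S) n :
  tcoef (f * g) n = \sum_(k < n.+1) tcoef f k * tcoef g (n - k) ^+ (q ^ k).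
Proof. by []. Qed.

Lemma tcoefMtau (f : S) n : tcoef (f * tstau) n = if n is m.+1 then tcoef f m else 0.
Proof.
rewrite tcoefM; case: n => [|n]; first by rewrite big_ord1 /= qexp0 mulr0.
rewrite big_ord_recr big_ord_recr /= subnn subSnn eqxx expr1n mulr1 qexp0.
rewrite mulr0 addr0 big1 ?add0r // => k _; rewrite eqn_leq subn_gt0.
by rewrite leqNgt ltn_subRL addn1 !ltnS ltn_ord /= qexp0 mulr0.
Qed.

Lemma tsconst_is_zmod : zmod_morphism tsconst.
Proof. by move=> a b; apply/tseriesP=> -[|n] //=; rewrite subrr. Qed.
Lemma tsconst_is_monoid : monoid_morphism tsconst.
Proof.
split=> // a b; apply/tseriesP=> n; rewrite tcoefM big_ord_recl /= subn0 expr1.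
rewrite big1 => [|k _]; last by rewrite mul0r.
by case: n => [|n]; rewrite ?mulr0 addr0.
Qed.
HB.instance Definition _ := GRing.isZmodMorphism.Build B S tsconst tsconst_is_zmod.
HB.instance Definition _ := GRing.isMonoidMorphism.Build B S tsconst tsconst_is_monoid.

Definition tpoly_pred : {pred S} :=
  fun f => `[< exists N, forall n, (N <= n)%N -> tcoef f n = 0 >].
Lemma tpoly_subring : subring_closed tpoly_pred.
Proof.
split=> [|f g|f g]; rewrite ?unfold_in.
- by apply/asboolP; exists 1%N => -[].
- move=> /asboolP[N fN] /asboolP[M gM]; apply/asboolP; exists (maxn N M) => n.
  by rewrite geq_max tcoefB => /andP[/fN-> /gM->]; rewrite subrr.
move=> /asboolP[N fN] /asboolP[M gM]; apply/asboolP; exists (N + M)%N => n nNM.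
rewrite tcoefM big1 // => k _; have [/fN->|kN] := leqP N k; first by rewrite mul0r.
rewrite gM ?qexp0 ?mulr0 // -(leq_add2l k) subnKC -1?ltnS ?ltn_ord //.
by apply: leq_trans nNM; rewrite leq_add2r ltnW.
Qed.
HB.instance Definition _ := GRing.isSubringClosed.Build S tpoly_pred tpoly_subring.

(* B[tau] is the subring of the series with finitely many nonzero coefficients. *)
Record tpoly := TPoly { tseries_of_tpoly : S; _ : tseries_of_tpoly \in tpoly_pred }.
HB.instance Definition _ := [isSub for tseries_of_tpoly].
HB.instance Definition _ := [Choice of tpoly by <:].
HB.instance Definition _ := [SubChoice_isSubNzRing of tpoly by <:].

Lemma tpolyC_subproof (b : B) : tsconst b \in tpoly_pred.
Proof. by apply/asboolP; exists 1%N => -[]. Qed.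
Definition tpolyC b := TPoly (tpolyC_subproof b).
Lemma tpolyC_is_zmod : zmod_morphism tpolyC.
Proof. by move=> a b; apply/val_inj/rmorphB. Qed.
Lemma tpolyC_is_monoid : monoid_morphism tpolyC.
Proof. by split=> [|a b]; apply/val_inj; rewrite /= ?rmorph1 // rmorphM. Qed.
HB.instance Definition _ := GRing.isZmodMorphism.Build B tpoly tpolyC tpolyC_is_zmod.
HB.instance Definition _ := GRing.isMonoidMorphism.Build B tpoly tpolyC tpolyC_is_monoid.

Lemma tau_subproof : tstau \in tpoly_pred.
Proof. by apply/asboolP; exists 2%N => -[|[]]. Qed.
Definition tau := TPoly tau_subproof.

Definition tpcst (P : tpoly) : B := tcoef (val P) 0.
Lemma tpcst_is_zmod : zmod_morphism tpcst.
Proof. by []. Qed.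
Lemma tpcst_is_monoid : monoid_morphism tpcst.
Proof. by split=> // P Q; rewrite /tpcst rmorphM tcoefM big_ord1 expr1. Qed.
HB.instance Definition _ := GRing.isZmodMorphism.Build tpoly B tpcst tpcst_is_zmod.
HB.instance Definition _ := GRing.isMonoidMorphism.Build tpoly B tpcst tpcst_is_monoid.

Lemma tpoly_divtau (P : tpoly) : exists Q, P = tpolyC (tpcst P) + Q * tau.
Proof.
case: P => f hf; have [N hN] := asboolP _ hf.
have gP : TSeries i (fun n => tcoef f n.+1) \in tpoly_pred.
  by apply/asboolP; exists N => n nN; apply: hN; rewrite leqW.
exists (TPoly gP); apply/val_inj/tseriesP=> n.
rewrite rmorphD rmorphM tcoefD tcoefMtau.
by case: n => [|n]; rewrite /= ?addr0 ?add0r.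
Qed.
End TwistedSeries.

Section Map.
Variables (F : finFieldType) (B B' : comNzRingType).
Variables (i : {rmorphism F -> B}) (i' : {rmorphism F -> B'}) (h : {rmorphism B -> B'}).
Definition tsmap (f : tseries i) : tseries i' := TSeries i' (fun n => h (tcoef f n)).
Lemma tsmap_is_zmod : zmod_morphism tsmap.
Proof. by move=> f g; apply/tseriesP=> n; apply: rmorphB. Qed.
Lemma tsmap_is_monoid : monoid_morphism tsmap.
Proof.
split=> [|f g]; apply/tseriesP=> n.
  by case: n => [|n]; [apply: rmorph1|apply: rmorph0].
rewrite [LHS]/= rmorph_sum tcoefM; apply: eq_bigr => k _.
by rewrite rmorphM rmorphXn.
Qed.
HB.instance Definition _ := GRing.isZmodMorphism.Build (tseries i) (tseries i') tsmap tsmap_is_zmod.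
HB.instance Definition _ := GRing.isMonoidMorphism.Build (tseries i) (tseries i') tsmap tsmap_is_monoid.
Lemma tpmap_subproof (P : tpoly i) : tsmap (val P) \in @tpoly_pred _ _ i'.
Proof.
case: P => P /= /asboolP[N hN]; apply/asboolP; exists N => n /hN /= ->.
exact: rmorph0.
Qed.
Definition tpmap (P : tpoly i) : tpoly i' := TPoly (tpmap_subproof P).
Lemma tpmap_is_zmod : zmod_morphism tpmap.
Proof. by move=> f g; apply/val_inj/rmorphB. Qed.
Lemma tpmap_is_monoid : monoid_morphism tpmap.
Proof. by split=> [|f g]; apply/val_inj; rewrite /= ?rmorph1 // rmorphM. Qed.
HB.instance Definition _ := GRing.isZmodMorphism.Build (tpoly i) (tpoly i') tpmap tpmap_is_zmod.
HB.instance Definition _ := GRing.isMonoidMorphism.Build (tpoly i) (tpoly i') tpmap tpmap_is_monoid.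
End Map.

(* Restriction of scalars along h. *)
Definition restr (S T : nzRingType) (h : {rmorphism S -> T}) (V : lmodType T) : Type := V.
Section Restriction.
Variables (S T : nzRingType) (h : {rmorphism S -> T}) (V : lmodType T).
Local Notation hV := (restr h V).
HB.instance Definition _ := GRing.Zmodule.on hV.
Definition rscale (s : S) (v : hV) : hV := h s *: (v : V).
Lemma rscaleA a b v : rscale a (rscale b v) = rscale (a * b) v.
Proof. by rewrite /rscale rmorphM scalerA. Qed.
Lemma rscale1 : left_id 1 rscale.
Proof. by move=> v; rewrite /rscale rmorph1 scale1r. Qed.
Lemma rscaleDr : right_distributive rscale +%R.
Proof. by move=> a u v; rewrite /rscale scalerDr. Qed.
Lemma rscaleDl v : {morph rscale^~ v : a b / a + b}.
Proof. by move=> a b; rewrite /rscale rmorphD scalerDl. Qed.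
HB.instance Definition _ :=
  GRing.Zmodule_isLmodule.Build S hV rscaleA rscale1 rscaleDr rscaleDl.
End Restriction.

Record action (A : comNzRingType) (T : nzRingType) (V : lmodType T) := Action {
  act :> A -> {linear V -> V};
  act1 : forall v, act 1 v = v;
  actM : forall a b v, act (a * b) v = act a (act b v);
  actD : forall a b v, act (a + b) v = act a v + act b v }.

(* Additive subgroups of S stable under right multiplication by t. *)
Record tsubmod (S : nzRingType) (t : S) := TSubmod {
  tset :> S -> Prop;
  tset0 : tset 0;
  tsetB : forall x y, tset x -> tset y -> tset (x - y);
  tsetM : forall x, tset x -> tset (x * t) }.

(* Hom_T(V, S), S being a T-module through h.  It is an A[X]-module, where
   (a f)(v) = f (a v) and (X f)(v) = f v * t; for t = tau this is the A[tau]-module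
   structure on Hom-groups (tau commutes with A, so A[tau] is {poly A}). *)
Section Homs.
Variables (T S : nzRingType) (h : {rmorphism T -> S}) (V : lmodType T).
Variables (A : comNzRingType) (rho : action A V) (t : S).

Record homt (h : {rmorphism T -> S}) (rho : action A V) (t : S) := Homt {
  homf :> V -> S;
  homf_lin : forall c u v, homf (c *: u + v) = h c * homf u + homf v }.
Local Notation H := (homt h rho t).
HB.instance Definition _ := gen_eqMixin H.
HB.instance Definition _ := gen_choiceMixin H.

Lemma homtP (f g : H) : (forall v, f v = g v) <-> f = g.
Proof.
split=> [|->//]; case: f g => [f hf] [g hg] /= /funext fg.
by rewrite -{}fg in hg *; congr Homt; apply: Prop_irrelevance.
Qed.

Lemma homtD (f : H) u v : f (u + v) = f u + f v.
Proof. by rewrite -[u]scale1r homf_lin rmorph1 mul1r scale1r. Qed.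
Lemma homt0 (f : H) : f 0 = 0.
Proof. by apply: (@addrI _ (f 0)); rewrite -homtD !addr0. Qed.
Lemma homtZ (f : H) c u : f (c *: u) = h c * f u.
Proof. by rewrite -[c *: u]addr0 homf_lin homt0 addr0. Qed.

Lemma hzero_lin c (u v : V) : (0 : S) = h c * 0 + 0.
Proof. by rewrite mulr0 addr0. Qed.
Definition hzero : H := Homt rho t hzero_lin.
Lemma hadd_lin (f g : H) c u v :
  f (c *: u + v) + g (c *: u + v) = h c * (f u + g u) + (f v + g v).
Proof. by rewrite !homf_lin mulrDr addrACA. Qed.
Definition hadd (f g : H) : H := Homt rho t (hadd_lin f g).
Lemma hopp_lin (f : H) c u v : - f (c *: u + v) = h c * (- f u) + (- f v).
Proof. by rewrite homf_lin opprD mulrN. Qed.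
Definition hopp (f : H) : H := Homt rho t (hopp_lin f).
Lemma haddA : associative hadd.
Proof. by move=> f g k; apply/homtP=> v; rewrite /= addrA. Qed.
Lemma haddC : commutative hadd.
Proof. by move=> f g; apply/homtP=> v; rewrite /= addrC. Qed.
Lemma hadd0 : left_id hzero hadd.
Proof. by move=> f; apply/homtP=> v; rewrite /= add0r. Qed.
Lemma haddN : left_inverse hzero hopp hadd.
Proof. by move=> f; apply/homtP=> v; rewrite /= addNr. Qed.
HB.instance Definition _ := GRing.isZmodule.Build H haddA haddC hadd0 haddN.

Lemma hscale_lin (p : {poly A}) (f : H) c u v :
  \sum_(i < size p) f (rho p`_i (c *: u + v)) * t ^+ i =
  h c * (\sum_(i < size p) f (rho p`_i u) * t ^+ i) +
  \sum_(i < size p) f (rho p`_i v) * t ^+ i.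
Proof.
rewrite big_distrr -big_split; apply: eq_bigr => i _ /=.
by rewrite linearP homf_lin mulrDl mulrA.
Qed.
Definition hscale p (f : H) : H := Homt rho t (hscale_lin p f).

Lemma act0 v : rho 0 v = 0.
Proof. by apply: (@addrI _ (rho 0 v)); rewrite -actD !addr0. Qed.

Lemma hscaleE n (p : {poly A}) (f : H) v : (size p <= n)%N ->
  hscale p f v = \sum_(i < n) f (rho p`_i v) * t ^+ i.
Proof.
move=> pn; rewrite /= (big_ord_widen _ (fun i => f (rho p`_i v) * t ^+ i) pn).
rewrite big_mkcond; apply: eq_bigr => i _; case: ltnP => // /(nth_default 0) ->.
by rewrite act0 homt0 mul0r.
Qed.

Lemma hscaleDl (f : H) : {morph hscale^~ f : p q / p + q}.
Proof.
move=> p q; apply/homtP=> v; pose n := maxn (size p) (size q).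
rewrite (@hscaleE n) ?size_polyD // -[RHS]/(hscale p f v + hscale q f v).
rewrite !(@hscaleE n) ?leq_maxl ?leq_maxr // -big_split; apply: eq_bigr => i _.
by rewrite coefD actD homtD mulrDl.
Qed.
Lemma hscaleDr : right_distributive hscale +%R.
Proof.
move=> p f g; apply/homtP=> v /=.
by rewrite -big_split; apply: eq_bigr => i _; rewrite mulrDl.
Qed.
Lemma hscaleC c f v : hscale c%:P f v = f (rho c v).
Proof. by rewrite (@hscaleE 1) ?size_polyC_leq1 // big_ord1 coefC mulr1. Qed.
Lemma hscale1 : left_id 1 hscale.
Proof. by move=> f; apply/homtP=> v; rewrite -polyC1 hscaleC act1. Qed.
Lemma hscaleMX p f v : hscale (p * 'X) f v = hscale p f v * t.
Proof.
rewrite (@hscaleE (size p).+1); last by rewrite (leq_trans (size_polyMleq _ _)) // size_polyX addn2.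
rewrite big_ord_recl coefMX /= act0 homt0 mul0r add0r big_distrl.
by apply: eq_bigr => i _; rewrite /= coefMX /= exprSr mulrA.
Qed.
Lemma hscaleCM c p f v : hscale (c%:P * p) f v = hscale p f (rho c v).
Proof.
rewrite (@hscaleE (size p)); last first.
  by rewrite mul_polyC size_scale_leq.
by apply: eq_bigr => i _; rewrite coefCM mulrC actM.
Qed.
Lemma hscaleA p q f : hscale p (hscale q f) = hscale (p * q) f.
Proof.
elim/poly_ind: p => [|p c ih]; apply/homtP=> v.
  by rewrite mul0r /= size_poly0 !big_ord0.
rewrite mulrDl !hscaleDl mulrAC.
rewrite -[LHS]/(hscale (p * 'X) _ v + hscale c%:P _ v).
rewrite -[RHS]/(hscale (p * q * 'X) _ v + hscale (c%:P * q) _ v).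
by rewrite !hscaleMX hscaleC hscaleCM ih.
Qed.
HB.instance Definition _ := GRing.Zmodule_isLmodule.Build {poly A} H
  hscaleA hscale1 hscaleDr hscaleDl.

Lemma homtpolyC c (f : H) v : (c%:P *: f) v = f (rho c v).
Proof. exact: hscaleC. Qed.
Lemma homtX (f : H) v : ('X *: f) v = f v * t.
Proof. by rewrite -['X]mul1r -[LHS]/(hscale _ _ _) hscaleMX hscale1. Qed.


(* The homomorphisms with values in X. *)
Definition hom_in_pred (X : tsubmod t) : {pred H} := fun f => `[< forall v, X (f v) >].
Lemma hom_in_submod X : submod_closed (hom_in_pred X).
Proof.
have XD x y : X x -> X y -> X (x + y).
  move=> hx hy; rewrite -[y]opprK; apply: (tsetB hx).
  by rewrite -sub0r; apply: tsetB => //; apply: tset0.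
split=> [|p f g]; rewrite ?unfold_in; first by apply/asboolP=> v; exact: tset0.
move=> /asboolP Xf /asboolP Xg; apply/asboolP=> v; apply: (XD); last exact: Xg.
move: v; elim/poly_ind: p => [|p c ih] v.
  by rewrite scale0r; exact: tset0.
rewrite scalerDl; apply: (XD); last by rewrite homtpolyC.
by rewrite -[_ *: _]/(hscale _ _) hscaleMX; apply: tsetM; apply: ih.
Qed.
HB.instance Definition _ X := GRing.isSubmodClosed.Build {poly A} H (hom_in_pred X) (hom_in_submod X).
Variable X : tsubmod t.
Record hom_in (X : tsubmod t) := HomIn { hom_of :> H; _ : hom_of \in hom_in_pred X }.
HB.instance Definition _ := [isSub for @hom_of X].
HB.instance Definition _ := [Choice of hom_in X by <:].
HB.instance Definition _ := [SubChoice_isSubLmodule of hom_in X by <:].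
End Homs.

Section FunctionField.
Variables (F : finFieldType) (K : fieldType) (const_emb : {rmorphism F -> K}).

(* K is a finite extension of F(x) for some x transcendental over F. *)
Definition is_function_field : Prop :=
  exists2 x : K, forall p : {poly F}, p != 0 -> (map_poly const_emb p).[x] != 0
  & exists n (b : 'I_n -> K), forall z : K,
      exists (d : {poly F}) (p : 'I_n -> {poly F}),
        d != 0 /\ (map_poly const_emb d).[x] * z = \sum_(i < n) (map_poly const_emb (p i)).[x] * b i.

(* O is a valuation ring of K / F; it is then automatically discrete.  For a smooth
   projective curve C with function field K, P |-> O_(C, P) is a bijection from the
   closed points of C to the valuation rings of K / F. *)
Definition is_place (O : set K) : Prop :=
  [/\ forall c, O (const_emb c),
      forall x y, O x -> O y -> O (x - y),
      forall x y, O x -> O y -> O (x * y),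
      forall x, O x \/ O x^-1
    & exists x, ~ O x].
End FunctionField.

(* A smooth projective curve C over F, given by its function field, with a closed
   point, given by its local ring. *)
Record pointed_curve (F : finFieldType) := PointedCurve {
  funfield :> fieldType;
  const_emb : {rmorphism F -> funfield};
  funfieldP : is_function_field const_emb;
  infty : set funfield;
  inftyP : is_place const_emb infty }.

Arguments infty {F} p _.
Section Rings.
Variables (F : finFieldType) (C : pointed_curve F).

(* O_C(C \ {infty}) is the intersection of the local rings at the other points. *)
Definition coord_ring_pred : {pred C} := fun a =>
  `[< forall O : set C, is_place (const_emb C) O -> O <> infty C -> O a >].
Lemma const_coord c : const_emb C c \in coord_ring_pred.
Proof. by apply/asboolP=> O [Oc _ _ _ _] _; exact: Oc. Qed.
Lemma coord_ring_subring : subring_closed coord_ring_pred.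
Proof.
split=> [|x y|x y]; first by rewrite -(rmorph1 (const_emb C)) const_coord.
- move=> /asboolP hx /asboolP hy; apply/asboolP=> O hO neO.
  by case: (hO) => _ OB _ _ _; apply: OB; [apply: hx|apply: hy].
- move=> /asboolP hx /asboolP hy; apply/asboolP=> O hO neO.
  by case: (hO) => _ _ OM _ _; apply: OM; [apply: hx|apply: hy].
Qed.
HB.instance Definition _ := GRing.isSubringClosed.Build C coord_ring_pred coord_ring_subring.
Record coord_ring := CoordRing { coord_val : C; _ : coord_val \in coord_ring_pred }.
HB.instance Definition _ := [isSub for coord_val].
HB.instance Definition _ := [Choice of coord_ring by <:].
HB.instance Definition _ := [SubChoice_isSubComNzRing of coord_ring by <:].
Definition constA (c : F) : coord_ring := CoordRing (const_coord c).

Variable L : fieldExtType C.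
Definition coord_to_ext : {rmorphism coord_ring -> L} := in_alg L \o val.
Definition constL : {rmorphism F -> L} := in_alg L \o const_emb C.
Definition intcl_pred : {pred L} := fun x => `[< integralOver coord_to_ext x >].
Lemma intcl_subring : subring_closed intcl_pred.
Proof.
split=> [|x y|x y]; first by apply/asboolP; exact: integral1.
- by move=> /asboolP hx /asboolP hy; apply/asboolP; exact: integral_sub.
- by move=> /asboolP hx /asboolP hy; apply/asboolP; exact: integral_mul.
Qed.
HB.instance Definition _ := GRing.isSubringClosed.Build L intcl_pred intcl_subring.
Record int_closure := Intcl { intcl_val : L; _ : intcl_val \in intcl_pred }.
HB.instance Definition _ := [isSub for intcl_val].
HB.instance Definition _ := [Choice of int_closure by <:].
HB.instance Definition _ := [SubChoice_isSubComNzRing of int_closure by <:].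
Definition intcl_emb : {rmorphism int_closure -> L} := val.

Lemma coord_intcl (a : coord_ring) : coord_to_ext a \in intcl_pred.
Proof. by apply/asboolP/integral_id. Qed.
Definition coord_to_intcl (a : coord_ring) : int_closure := Intcl (coord_intcl a).
Definition constR_fun (c : F) : int_closure := coord_to_intcl (constA c).
Lemma constR_is_zmod : zmod_morphism constR_fun.
Proof. by move=> a b; apply/val_inj; rewrite /= rmorphB scalerBl. Qed.
Lemma constR_is_monoid : monoid_morphism constR_fun.
Proof.
split=> [|a b]; apply/val_inj; first by rewrite /= rmorph1 scale1r.
by rewrite /= (rmorphM (const_emb C)) -[LHS]/(in_alg L _) rmorphM.
Qed.
HB.instance Definition _ := GRing.isZmodMorphism.Build F int_closure constR_fun constR_is_zmod.
HB.instance Definition _ := GRing.isMonoidMorphism.Build F int_closure constR_fun constR_is_monoid.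
Definition constR : {rmorphism F -> int_closure} := constR_fun.

Record ideal := Ideal {
  ideal_set :> int_closure -> Prop;
  ideal0 : ideal_set 0;
  idealB : forall x y, ideal_set x -> ideal_set y -> ideal_set (x - y);
  idealM : forall r x, ideal_set x -> ideal_set (r * x) }.
End Rings.

Definition absolute_value (RR : realType) (k : nzRingType) (v : k -> RR) : Prop :=
  [/\ forall x, 0 <= v x,
      forall x, v x = 0 <-> x = 0,
      forall x y, v (x * y) = v x * v y
    & forall x y, v (x + y) <= Num.max (v x) (v y)].

(* K_infty: a complete valued field containing K as a dense subfield, whose absolute
   value has O_(C, infty) as unit ball on K.  This determines the absolute value up to
   a positive power, i.e. up to the choice of c > 1 in |x| = c ^ (- ord_infty x). *)
Record completion (F : finFieldType) (C : pointed_curve F) (RR : realType) := Completion {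
  Kinf :> fieldType;
  absK : Kinf -> RR;
  absKP : absolute_value absK;
  embK : {rmorphism C -> Kinf};
  absK_infty : forall x, absK (embK x) <= 1 <-> infty C x;
  embK_dense : forall y (e : RR), 0 < e -> exists x, absK (y - embK x) < e;
  Kinf_complete : forall u : nat -> Kinf,
    (forall e : RR, 0 < e -> exists N, forall m n, (N <= m)%N -> (N <= n)%N ->
        absK (u m - u n) < e) ->
    exists l, forall e : RR, 0 < e -> exists N, forall n, (N <= n)%N -> absK (u n - l) < e }.

(* L_infty = L (x)_K K_infty, with its decomposition into a product of finite
   extensions of K_infty and the absolute values extending absK on the factors. *)
Record ext_completion (F : finFieldType) (C : pointed_curve F) (L : fieldExtType C)
    (RR : realType) (V : completion C RR) := ExtCompletion {
  Linf :> comAlgType V;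
  embL : {rmorphism L -> Linf};
  embL_alg : forall x : C, embL x%:A = (embK V x)%:A;
  Linf_tensor :
    bijective (tlift (fun (c : V) (l : L) => c *: embL l) : tens (embK V) L -> Linf);
  nfactors : nat;
  Lfactor : 'I_nfactors -> fieldExtType V;
  proj : forall w, {lrmorphism Linf -> Lfactor w};
  proj_inj : forall x y, (forall w, proj w x = proj w y) -> x = y;
  proj_surj : forall y : (forall w, Lfactor w), exists x, forall w, proj w x = y w;
  absF : forall w, Lfactor w -> RR;
  absFP : forall w, absolute_value (@absF w);
  absF_ext : forall w (c : V), @absF w c%:A = absK c }.

Section Series.
Variables (F : finFieldType) (C : pointed_curve F) (L : fieldExtType C).
Variables (RR : realType) (V : completion C RR) (W : ext_completion L V).
Local Notation q := #|F|.

Definition Lnorm (x : W) : RR := \big[Num.max/0]_(w < nfactors W) absF (proj w x).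

Lemma Lnorm_ge0 x : 0 <= Lnorm x.
Proof.
rewrite /Lnorm; elim/big_ind: _ => // [a b a0 b0|w _]; first by rewrite le_max a0.
by case: (absFP w).
Qed.
Lemma Lnorm0 : Lnorm 0 = 0.
Proof.
rewrite /Lnorm big1_idem //= ?maxxx // => w _.
by rewrite linear0; case: (absFP w) => _ + _ _ => /(_ 0)[_ ->].
Qed.
Lemma LnormN x : Lnorm (- x) = Lnorm x.
Proof.
rewrite /Lnorm; apply: eq_bigr => w _; rewrite linearN.
case: (absFP w) => h0 hz hM _.
have h1 : absF (1 : Lfactor w) * absF (1 : Lfactor w) = absF (1 : Lfactor w) by rewrite -hM mulr1.
have n1 : absF (1 : Lfactor w) = 1.
  apply: (@mulIf _ (absF (1 : Lfactor w))); last by rewrite h1 mul1r.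
  by apply/eqP=> /hz/eqP; rewrite oner_eq0.
have nN1 : absF (-1 : Lfactor w) = 1.
  have /eqP : absF (-1 : Lfactor w) ^+ 2 = 1 by rewrite expr2 -hM mulrNN mulr1.
  rewrite sqrf_eq1 => /orP[/eqP//|/eqP e]; have := h0 (-1); rewrite e.
  by rewrite lerNr oppr0 real_leNgt ?num_real // ltr01.
by rewrite -mulN1r hM nN1 mul1r.
Qed.
Lemma LnormD x y : Lnorm (x + y) <= Num.max (Lnorm x) (Lnorm y).
Proof.
rewrite {1}/Lnorm; elim/big_ind: _ => [|a b ha hb|w _].
- by rewrite le_max Lnorm_ge0.
- by rewrite ge_max ha.
rewrite linearD; case: (absFP w) => _ _ _ /(_ (proj w x) (proj w y))/le_trans; apply.
have h z : absF (proj w z) <= Lnorm z by rewrite /Lnorm; apply: le_bigmax.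
by rewrite ge_max !le_max !h orbT.
Qed.

Definition constLinf : {rmorphism F -> W} := embL W \o constL L.
Local Notation S := (tseries constLinf).

(* f belongs to L_infty<tau; r>. *)
Definition decays (r : RR) (f : S) : Prop :=
  (fun n => Lnorm (tcoef f n) * r ^+ (q ^ n)) @ \oo --> (0 : RR).

Lemma decays_le (r s : RR) (f : S) : 0 <= r -> r <= s -> decays s f -> decays r f.
Proof.
move=> r0 rs; rewrite /decays => hs; apply: (squeeze_cvgr _ (cvg_cst 0) hs).
apply: nearW => n; rewrite mulr_ge0 ?Lnorm_ge0 ?exprn_ge0 //=.
by apply: ler_wpM2l; rewrite ?Lnorm_ge0 // lerXn2r // nnegrE // (le_trans r0).
Qed.
Lemma decays0 r : decays r 0.
Proof.
rewrite /decays (_ : (fun n => _) = fun=> 0); first exact: cvg_cst.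
by apply/funext => n; rewrite tcoef0 Lnorm0 mul0r.
Qed.
Lemma decaysB r (f g : S) : 0 <= r -> decays r f -> decays r g -> decays r (f - g).
Proof.
move=> r0 hf hg.
have h : (fun n => Lnorm (tcoef f n) * r ^+ (q ^ n) + Lnorm (tcoef g n) * r ^+ (q ^ n))
    @ \oo --> (0 : RR) by rewrite -[X in _ --> X]addr0; exact: cvgD hf hg.
rewrite /decays; apply: (squeeze_cvgr _ (cvg_cst 0) h); apply: nearW => n /=.
have rn0 : 0 <= r ^+ (q ^ n) by rewrite exprn_ge0.
rewrite mulr_ge0 ?Lnorm_ge0 //= -mulrDl ler_wpM2r //.
rewrite (le_trans (LnormD _ _)) // LnormN ge_max.
by rewrite lerDl lerDr !Lnorm_ge0.
Qed.
Lemma decays_tau r (f : S) : decays (r ^+ q) f -> decays r (f * tstau _).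
Proof.
rewrite /decays => h; rewrite -(cvg_shiftn 1).
rewrite (_ : (fun n => _) = (fun n => Lnorm (tcoef f n) * (r ^+ q) ^+ (q ^ n))) //.
by apply/funext => n; rewrite addn1 tcoefMtau -exprM expnS.
Qed.

Lemma tate_subproof0 : decays 1 0. Proof. exact: decays0. Qed.
Lemma tate_subproofB (f g : S) : decays 1 f -> decays 1 g -> decays 1 (f - g).
Proof. exact: decaysB. Qed.
Lemma tate_subproofM (f : S) : decays 1 f -> decays 1 (f * tstau _).
Proof. by move=> h; apply: decays_tau; rewrite expr1n. Qed.
(* L_infty<tau> *)
Definition tate : tsubmod (tstau constLinf) :=
  TSubmod tate_subproof0 tate_subproofB tate_subproofM.

Definition overconv (f : S) : Prop := exists2 r : RR, 1 < r & decays r f.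
Lemma overconv0 : overconv 0.
Proof. by exists 2; [rewrite ltr1n|exact: decays0]. Qed.
Lemma overconvB (f g : S) : overconv f -> overconv g -> overconv (f - g).
Proof.
move=> [r r1 hf] [s s1 hg]; exists (Num.min r s); first by rewrite lt_min r1.
have m0 : 0 <= Num.min r s by rewrite le_min !(le_trans ler01) // ltW.
by apply: decaysB => //; [move: hf|move: hg]; apply: decays_le => //;
  rewrite ge_min lexx ?orbT.
Qed.
Lemma overconvM (f : S) : overconv f -> overconv (f * tstau _).
Proof.
move=> [r r1 hf]; have q0 : (0 < q)%N by rewrite ltnW // finNzRing_gt1.
exists (r `^ (q%:R)^-1); 
  first by rewrite -[X in X < _](congr1 (@^~ (q%:R)^-1) (powR1 RR)) gt0_ltr_powR ?invr_gt0 ?ltr0n // nnegrE ltW // (lt_trans ltr01).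
apply: decays_tau; rewrite -powR_mulrn ?powR_ge0 // -powRrM mulVf ?pnatr_eq0 -?lt0n //.
by rewrite powRr1 // (le_trans ler01) // ltW.
Qed.
(* L_infty<tau>^dagger *)
Definition dagger : tsubmod (tstau constLinf) := TSubmod overconv0 overconvB overconvM.

Lemma dagger_tate (f : S) : dagger f -> tate f.
Proof. by move=> [r r1]; apply: decays_le => //; exact: ltW. Qed.

Local Notation Rtau := (tpoly (constR L)).
Definition intcl_Linf : {rmorphism int_closure L -> W} := embL W \o intcl_emb L.
Definition emb_tpoly : {rmorphism Rtau -> S} := tsmap _ intcl_Linf \o val.

Definition poly_in (J : ideal L) (f : S) : Prop :=
  exists2 P : Rtau, forall n, J (tcoef (val P) n) & f = emb_tpoly P.
Lemma poly_in0 J : poly_in J 0.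
Proof. by exists 0; [move=> n; rewrite tcoef0; exact: ideal0|rewrite rmorph0]. Qed.
Lemma poly_inB J f g : poly_in J f -> poly_in J g -> poly_in J (f - g).
Proof.
move=> [P hP ->] [Q hQ ->]; exists (P - Q); last by rewrite rmorphB.
by move=> n; apply: idealB.
Qed.
Lemma poly_inM J f : poly_in J f -> poly_in J (f * tstau _).
Proof.
move=> [P hP ->]; exists (P * tau _).
  by move=> n; rewrite [val _]/= tcoefMtau; case: n => // ; exact: ideal0.
rewrite rmorphM; congr (_ * _); apply/tseriesP => n.
symmetry; exact: (rmorph_nat intcl_Linf (n == 1%N)).
Qed.
(* J[tau], inside L_infty[[tau]] *)
Definition polyJ (J : ideal L) : tsubmod (tstau constLinf) :=
  TSubmod (poly_in0 J) (@poly_inB J) (@poly_inM J).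
End Series.

Section ProjectiveModules.
Variables (S : nzRingType) (P : lmodType S).
Definition finitely_generated : Prop :=
  exists n (f : {linear 'rV[S]_n -> P}), forall x, exists y, f y = x.
Definition projective : Prop :=
  forall (N N' : lmodType S) (g : {linear N -> N'}) (f : {linear P -> N'}),
    (forall y, exists x, g x = y) -> exists f' : {linear P -> N}, forall x, g (f' x) = f x.
End ProjectiveModules.

Section Motives.
Variables (F : finFieldType) (C : pointed_curve F) (L : fieldExtType C).
Local Notation A := (coord_ring C).
Local Notation R := (int_closure L).
Local Notation Rtau := (tpoly (constR L)).
Local Notation Ltau := (tpoly (constL L)).

(* Left modules over A (x)_F R[tau]: the actions of A and R[tau] commute and agree
   on F. *)
Record tmodule := TModule {
  tmod :> lmodType Rtau;
  tact : action A tmod;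
  tact_const : forall c m, tact (constA C c) m = tpolyC (constR L) (constR L c) *: m }.

Section Lie.
Variable M : tmodule.
Definition tauM_pred : {pred M} := fun x =>
  `[< exists s : seq (Rtau * M), x = \sum_(p <- s) p.1 *: (tau (constR L) *: p.2) >].
Lemma tauM_submod : submod_closed tauM_pred.
Proof.
split=> [|a x y]; rewrite ?unfold_in.
  by apply/asboolP; exists [::]; rewrite big_nil.
move=> /asboolP[s ->] /asboolP[s' ->]; apply/asboolP.
exists ([seq (a * p.1, p.2) | p <- s] ++ s'); rewrite big_cat big_map scaler_sumr.
by congr +%R; apply: eq_bigr => p _; rewrite [LHS]scalerA.
Qed.
HB.instance Definition _ := GRing.isSubmodClosed.Build Rtau M tauM_pred tauM_submod.
(* R[tau] tau M is a left R[tau]-submodule; Lie(M) is the quotient, seen as an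
   R-module. *)
Definition Lie : lmodType R := restr (tpolyC (constR L)) (quot tauM_pred).
Definition lie_class (m : M) : Lie := qpi tauM_pred m.

Lemma tauM_act a x : x \in tauM_pred -> tact M a x \in tauM_pred.
Proof.
move=> /asboolP[s ->]; apply/asboolP; exists [seq (p.1, tact M a p.2) | p <- s].
by rewrite linear_sum big_map; apply: eq_bigr => p _; rewrite !linearZ.
Qed.
Definition lie_act_fun (a : A) (x : Lie) : Lie := lie_class (tact M a (repr (x : quot tauM_pred))).
Lemma lie_actE a m : lie_act_fun a (lie_class m) = lie_class (tact M a m).
Proof. by apply/qpiP; rewrite -linearB; apply/tauM_act/qrepr. Qed.
Lemma lieW (P : Lie -> Prop) : (forall m, P (lie_class m)) -> forall x, P x.
Proof. exact: qpiW. Qed.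
Lemma lie_classD m m' : lie_class (m + m') = lie_class m + lie_class m'.
Proof. exact: (linearD (qpi tauM_pred)). Qed.
Lemma lie_classZ r m : lie_class (tpolyC (constR L) r *: m) = r *: lie_class m.
Proof. exact: (linearZ_LR (qpi tauM_pred)). Qed.
Lemma lie_class_tau m : lie_class (tau (constR L) *: m) = 0.
Proof.
apply/qpiP; rewrite subr0; apply/asboolP; exists [:: (1, m)].
by rewrite big_seq1 scale1r.
Qed.
Lemma lie_act_is_linear a : linear (lie_act_fun a).
Proof.
move=> r; elim/lieW=> m; elim/lieW=> m'.
by rewrite -lie_classZ -lie_classD !lie_actE linearP lie_classD lie_classZ.
Qed.
HB.instance Definition _ a :=
  GRing.isLinear.Build R Lie Lie _ (lie_act_fun a) (lie_act_is_linear a).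
Lemma lie_act1 x : lie_act_fun 1 x = x.
Proof. by elim/lieW: x => m; rewrite lie_actE act1. Qed.
Lemma lie_actM a b x : lie_act_fun (a * b) x = lie_act_fun a (lie_act_fun b x).
Proof. by elim/lieW: x => m; rewrite !lie_actE actM. Qed.
Lemma lie_actD a b x : lie_act_fun (a + b) x = lie_act_fun a x + lie_act_fun b x.
Proof. by elim/lieW: x => m; rewrite !lie_actE actD lie_classD. Qed.
Definition lie_act : action A Lie := @Action A R Lie lie_act_fun lie_act1 lie_actM lie_actD.
End Lie.

Definition anderson_motive (M : tmodule) : Prop :=
  [/\ finitely_generated M,
      projective M
    & forall a : A, exists n, forall x : Lie M,
        iter n (fun y => lie_act M a y - coord_to_intcl L a *: y) x = 0].

Section Exponential.
Variable M : tmodule.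

Definition tpoly_ext : {rmorphism Rtau -> Ltau} := tpmap (constL L) (intcl_emb L).
(* M_L = L[tau] (x)_(R[tau]) M and L (x)_R Lie(M), with the map sending the class
   of P (x) m to that of P_0 (x) m, P_0 the constant term of P. *)
Definition ML : lmodType Ltau := tens tpoly_ext M.
Definition ML_act (a : A) : ML -> ML :=
  tlift (fun P (m : M) => tpure tpoly_ext P (tact M a m)).
Definition LieL : lmodType L := tens (intcl_emb L) (Lie M).
Definition ML_class : ML -> LieL :=
  tlift (fun P (m : M) => tpure (intcl_emb L) (tpcst P) (lie_class m)).

(* A basis of M_L, the matrices phi(a) in it, and the series exp with constant term
   Id such that exp * dphi(a) = phi(a) * exp. *)
Record exponential := Exponential {
  erank : nat;
  ebasis : 'I_erank -> ML;
  ebasisP : bijective (fun c : 'rV[Ltau]_erank => \sum_i c 0 i *: ebasis i);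
  ephi : A -> 'M[Ltau]_erank;
  ephiP : forall a i, ML_act a (ebasis i) = \sum_j ephi a i j *: ebasis j;
  eexp : 'M[tseries (constL L)]_erank;
  eexp_id : map_mx (fun f => tcoef f 0) eexp = 1%:M;
  eexpP : forall a,
    eexp *m map_mx (fun P => tsconst (constL L) (tpcst P)) (ephi a) =
    map_mx val (ephi a) *m eexp }.

Section Maps.
Variables (RR : realType) (V : completion C RR) (W : ext_completion L V).
Local Notation S := (tseries (constLinf W)).

Definition intcl_const : {rmorphism R -> S} := tsconst (constLinf W) \o intcl_Linf W.
(* E_M and Lie_M of L_infty[[tau]] *)
Definition EM : lmodType {poly A} := homt (emb_tpoly W) (tact M) (tstau (constLinf W)).
Definition LieM : lmodType {poly A} := homt intcl_const (lie_act M) (tstau (constLinf W)).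

Definition embS : {rmorphism tseries (constL L) -> S} := tsmap (constLinf W) (embL W).
Definition embP : {rmorphism Ltau -> S} := embS \o val.

(* The L-linear extensions of f to M_L, respectively to L (x)_R Lie(M); they give a
   meaning to the values of f on the basis of M_L. *)
Definition extE (f : EM) : ML -> S := tlift (fun P (m : M) => embP P * f m).
Definition extLie (f : LieM) : LieL -> S :=
  tlift (fun l (x : Lie M) => tsconst (constLinf W) (embL W l) * f x).

Lemma ML_act_balanced a : balanced tpoly_ext (fun P (m : M) => tpure tpoly_ext P (tact M a m)).
Proof.
case: (tpure_balanced tpoly_ext M) => b1 b2 b3; split=> *.
- by rewrite b1.
- by rewrite linearD b2.
- by rewrite linearZ b3.
Qed.
Lemma lie_class_scale (P : Rtau) (m : M) : lie_class (P *: m) = tpcst P *: lie_class m.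
Proof.
have [Q {1}->] := tpoly_divtau P.
rewrite scalerDl lie_classD lie_classZ -scalerA.
have -> : lie_class (Q *: (tau (constR L) *: m)) = 0; last by rewrite addr0.
apply: etrans (linearZ_LR (qpi (@tauM_pred M)) Q _) _ => /=.
by rewrite [X in Q *: X](lie_class_tau m); exact: (scaler0 (quot (@tauM_pred M))).
Qed.
Lemma ML_class_balanced :
  balanced tpoly_ext (fun P (m : M) => tpure (intcl_emb L) (tpcst P) (lie_class m)).
Proof.
case: (tpure_balanced (intcl_emb L) (Lie M)) => b1 b2 b3; split=> [P P' m|P m m'|P r m].
- by rewrite rmorphD b1.
- by rewrite lie_classD b2.
- by rewrite rmorphM /= -[tpcst (tpoly_ext r)]/(intcl_emb L (tpcst r)) b3 lie_class_scale.
Qed.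
Lemma extE_balanced (f : EM) : balanced tpoly_ext (fun P (m : M) => embP P * f m).
Proof.
split=> [P P' m|P m m'|P r m].
- by rewrite rmorphD mulrDl.
- by rewrite homtD mulrDr.
- by rewrite rmorphM homtZ mulrA.
Qed.
Lemma extLie_balanced (f : LieM) :
  balanced (intcl_emb L) (fun l (x : Lie M) => tsconst (constLinf W) (embL W l) * f x).
Proof.
split=> [l l' m|l m m'|l r m].
- by rewrite !rmorphD mulrDl.
- by rewrite homtD mulrDr.
- by rewrite !rmorphM homtZ mulrA.
Qed.

Lemma extE_is_zmod f : zmod_morphism (extE f).
Proof.
move=> x y; have h u v : extE f (u + v) = extE f u + extE f v.
  exact/tliftD/extE_balanced.
by apply: (addIr (extE f y)); rewrite -h !subrK.
Qed.
Lemma ML_act_add a x y : ML_act a (x + y) = ML_act a x + ML_act a y.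
Proof. exact/tliftD/ML_act_balanced. Qed.
Lemma ML_class_add x y : ML_class (x + y) = ML_class x + ML_class y.
Proof. exact/tliftD/ML_class_balanced. Qed.
Lemma extE_add f x y : extE f (x + y) = extE f x + extE f y.
Proof. exact/tliftD/extE_balanced. Qed.
Lemma extLie_add f x y : extLie f (x + y) = extLie f x + extLie f y.
Proof. exact/tliftD/extLie_balanced. Qed.
Lemma ML_act_pure a P m : ML_act a (tpure tpoly_ext P m) = tpure tpoly_ext P (tact M a m).
Proof. exact: (tlift_pure _ _ (ML_act_balanced a)). Qed.
Lemma ML_class_pure P (m : M) :
  ML_class (tpure tpoly_ext P m) = tpure (intcl_emb L) (tpcst P) (lie_class m).
Proof. exact: (tlift_pure _ _ ML_class_balanced). Qed.
Lemma extE_pure f P m : extE f (tpure tpoly_ext P m) = embP P * f m.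
Proof. exact: (tlift_pure _ _ (extE_balanced f)). Qed.
Lemma extLie_pure f l x :
  extLie f (tpure (intcl_emb L) l x) = tsconst (constLinf W) (embL W l) * f x.
Proof. exact: (tlift_pure _ _ (extLie_balanced f)). Qed.

Lemma additive0 (U U' : zmodType) (g : U -> U') : (forall x y, g (x + y) = g x + g y) -> g 0 = 0.
Proof. by move=> h; apply: (@addrI _ (g 0)); rewrite -h !addr0. Qed.

Definition extLieM (f : LieM) (x : ML) : S := extLie f (ML_class x).
Lemma extLieM_add f x y : extLieM f (x + y) = extLieM f x + extLieM f y.
Proof. by rewrite /extLieM ML_class_add extLie_add. Qed.
Lemma extLieM_pure f P (m : M) :
  extLieM f (tpure tpoly_ext P m) = tsconst (constLinf W) (embL W (tpcst P)) * f (lie_class m).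
Proof. by rewrite /extLieM ML_class_pure extLie_pure. Qed.

Lemma MLext (G : zmodType) (g g' : ML -> G) :
  (forall x y, g (x + y) = g x + g y) -> (forall x y, g' (x + y) = g' x + g' y) ->
  (forall P m, g (tpure tpoly_ext P m) = g' (tpure tpoly_ext P m)) -> g =1 g'.
Proof.
move=> hg hg' e; apply: tens_ind => [|P m x ih].
  by rewrite !additive0.
by rewrite hg hg' e ih.
Qed.

Lemma extE_scale f P x : extE f (P *: x) = embP P * extE f x.
Proof.
move: x; apply: MLext => [x y|x y|P' m].
- by rewrite scalerDr extE_add.
- by rewrite extE_add mulrDr.
- by rewrite tscale_pure !extE_pure rmorphM mulrA.
Qed.
Lemma extLieM_scale f P x :
  extLieM f (P *: x) = tsconst (constLinf W) (embL W (tpcst P)) * extLieM f x.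
Proof.
move: x; apply: MLext => [x y|x y|P' m].
- by rewrite scalerDr extLieM_add.
- by rewrite extLieM_add mulrDr.
- by rewrite tscale_pure !extLieM_pure !rmorphM mulrA.
Qed.
Lemma extE_act f a x : extE f (ML_act a x) = extE (a%:P *: f) x.
Proof.
move: x; apply: MLext => [x y|x y|P' m].
- by rewrite ML_act_add extE_add.
- by rewrite extE_add.
- by rewrite ML_act_pure !extE_pure homtpolyC.
Qed.
Lemma extLieM_act f a x : extLieM f (ML_act a x) = extLieM (a%:P *: f) x.
Proof.
move: x; apply: MLext => [x y|x y|P' m].
- by rewrite ML_act_add extLieM_add.
- by rewrite extLieM_add.
- by rewrite ML_act_pure !extLieM_pure homtpolyC [in RHS]/lie_act /= lie_actE.
Qed.
Lemma extLieM_addf f g x : extLieM (f + g) x = extLieM f x + extLieM g x.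
Proof.
move: x; apply: MLext => [x y|x y|P' m].
- by rewrite extLieM_add.
- by rewrite !extLieM_add addrACA.
- by rewrite !extLieM_pure -mulrDr.
Qed.
Lemma extLieM_X f x : extLieM ('X *: f) x = extLieM f x * tstau _.
Proof.
move: x; apply: MLext => [x y|x y|P' m].
- by rewrite extLieM_add.
- by rewrite extLieM_add mulrDl.
- by rewrite !extLieM_pure homtX mulrA.
Qed.

Variable e : exponential.
Lemma ecoord_ex : exists c : ML -> 'rV[Ltau]_(erank e),
  cancel (fun c : 'rV_(erank e) => \sum_i c 0 i *: ebasis i) c /\
  cancel c (fun c : 'rV_(erank e) => \sum_i c 0 i *: ebasis i).
Proof. by case: (ebasisP e) => c h1 h2; exists c. Qed.
Definition ecoord : ML -> 'rV[Ltau]_(erank e) := projT1 (cid ecoord_ex).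
Lemma ecoordK x : \sum_i ecoord x 0 i *: ebasis i = x.
Proof. by rewrite /ecoord; case: cid => c [] /= _ /(_ x). Qed.
Lemma ecoord_sum (c : 'rV_(erank e)) : ecoord (\sum_i c 0 i *: ebasis i) = c.
Proof. by rewrite /ecoord; case: cid => c' [] /= /(_ c). Qed.
Lemma ecoord_linear a x y : ecoord (a *: x + y) = a *: ecoord x + ecoord y.
Proof.
rewrite -[x in LHS]ecoordK -[y in LHS]ecoordK scaler_sumr -big_split /=.
rewrite -[RHS]ecoord_sum; congr ecoord; apply: eq_bigr => i _.
by rewrite !mxE scalerDl scalerA.
Qed.
Lemma ecoordD x y : ecoord (x + y) = ecoord x + ecoord y.
Proof. by rewrite -[x in LHS]scale1r ecoord_linear scale1r. Qed.
Lemma ecoordZ a x : ecoord (a *: x) = a *: ecoord x.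
Proof. by rewrite -[a *: x]addr0 ecoord_linear additive0 ?addr0 //; exact: ecoordD. Qed.
Lemma ecoord_basis i : ecoord (ebasis i) = delta_mx 0 i.
Proof.
rewrite -[RHS]ecoord_sum; congr ecoord.
rewrite (bigD1 i) //= !mxE !eqxx scale1r big1 ?addr0 // => j ji.
by rewrite mxE (negPf ji) andbF scale0r.
Qed.

(* exp_M f is the element of E_M whose values on the basis of M_L are the
   exp_basis f i; see extE_exp_basis. *)
Definition exp_basis (f : LieM) (i : 'I_(erank e)) : S :=
  \sum_j embS (eexp e i j) * extLieM f (ebasis j).
Definition expM_fun (f : LieM) (m : M) : S :=
  \sum_i embP (ecoord (tpure tpoly_ext 1 m) 0 i) * exp_basis f i.
Lemma expM_lin f c u v : expM_fun f (c *: u + v) = emb_tpoly W c * expM_fun f u + expM_fun f v.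
Proof.
rewrite /expM_fun big_distrr -big_split; apply: eq_bigr => i _ /=.
have [b1 b2 b3] := tpure_balanced tpoly_ext M.
rewrite b2 -b3 mul1r -[tpoly_ext c]mulr1 -tscale_pure ecoord_linear !mxE.
rewrite rmorphD mulrDl rmorphM mulrA.
by congr (_ * _ * _ + _); apply/tseriesP.
Qed.
Definition expM_raw (f : LieM) : EM := Homt (tact M) (tstau _) (expM_lin f).

Lemma extE_exp f x : extE (expM_raw f) x = \sum_i embP (ecoord x 0 i) * exp_basis f i.
Proof.
move: x; apply: MLext => [x y|x y|P m].
- exact: extE_add.
- rewrite -big_split; apply: eq_bigr => i _ /=.
  by rewrite ecoordD !mxE rmorphD mulrDl.
rewrite extE_pure /= /expM_fun big_distrr; apply: eq_bigr => i _ /=.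
by rewrite mulrA -rmorphM -[in RHS](mulr1 P) -tscale_pure ecoordZ mxE.
Qed.
Lemma extE_exp_basis f i :
  extE (expM_raw f) (ebasis i) = \sum_j embS (eexp e i j) * extLieM f (ebasis j).
Proof.
rewrite extE_exp (bigD1 i) //= big1 => [|j ji]; rewrite ecoord_basis mxE ?eqxx.
  by rewrite rmorph1 mul1r addr0.
by rewrite (negPf ji) rmorph0 mul0r.
Qed.
Lemma extE_inj (f g : EM) : (forall i, extE f (ebasis (e := e) i) = extE g (ebasis i)) -> f = g.
Proof.
move=> fg; apply/homtP=> m.
have E x : extE f x = extE g x.
  rewrite -(ecoordK x) !(big_morph (extE _) (extE_add _) (additive0 (extE_add _))).
  by apply: eq_bigr => i _; rewrite !extE_scale fg.
by have := E (tpure tpoly_ext 1 m); rewrite !extE_pure rmorph1 !mul1r.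
Qed.

Lemma expM_raw_add f g : expM_raw (f + g) = expM_raw f + expM_raw g.
Proof.
apply/homtP=> m; rewrite -[RHS]/(expM_fun f m + expM_fun g m) /= /expM_fun -big_split.
apply: eq_bigr => i _ /=; rewrite -mulrDr; congr (_ * _).
rewrite /exp_basis -big_split; apply: eq_bigr => j _ /=.
by rewrite extLieM_addf mulrDr.
Qed.
Lemma expM_raw_X f : expM_raw ('X *: f) = 'X *: expM_raw f.
Proof.
apply/homtP=> m; rewrite homtX /= /expM_fun big_distrl.
apply: eq_bigr => i _ /=; rewrite -mulrA; congr (_ * _).
rewrite /exp_basis big_distrl; apply: eq_bigr => j _ /=.
by rewrite extLieM_X mulrA.
Qed.
Lemma expM_raw_C a f : expM_raw (a%:P *: f) = a%:P *: expM_raw f.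
Proof.
apply: extE_inj => i; rewrite extE_exp_basis -extE_act ephiP.
rewrite (big_morph (extE _) (extE_add _) (additive0 (extE_add _))).
under [RHS]eq_bigr => j _ do rewrite extE_scale extE_exp_basis big_distrr /=.
under [LHS]eq_bigr => j _ do rewrite -extLieM_act ephiP
  (big_morph (extLieM f) (extLieM_add f) (additive0 (extLieM_add f))) big_distrr /=.
rewrite exchange_big [RHS]exchange_big; apply: eq_bigr => k _ /=.
under eq_bigr => j _ do rewrite extLieM_scale mulrA.
under [RHS]eq_bigr => j _ do rewrite mulrA.
rewrite -!big_distrl /=; congr (_ * _).
have /matrixP/(_ i k) := eexpP e a; rewrite !mxE => /(congr1 embS).
rewrite !rmorph_sum /= => E; apply: etrans (etrans E _).
  apply: eq_bigr => j _; rewrite mxE rmorphM; congr (_ * _).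
  by apply/tseriesP=> -[|n] //=; rewrite rmorph0.
by apply: eq_bigr => j _; rewrite mxE rmorphM.
Qed.
Lemma expM_is_linear : linear expM_raw.
Proof.
move=> p f g; rewrite expM_raw_add; congr (_ + _).
elim/poly_ind: p => [|p c ih]; first by rewrite !scale0r; exact: (additive0 expM_raw_add).
rewrite !scalerDl expM_raw_add expM_raw_C; congr (_ + _).
by rewrite mulrC -!scalerA expM_raw_X ih.
Qed.
HB.instance Definition _ := GRing.isLinear.Build {poly A} LieM EM _ expM_raw expM_is_linear.
Definition expM : {linear LieM -> EM} := expM_raw.

Definition LieM_in (X : tsubmod (tstau (constLinf W))) : lmodType {poly A} :=
  hom_in intcl_const (lie_act M) X.
Definition EM_in (X : tsubmod (tstau (constLinf W))) : lmodType {poly A} :=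
  hom_in (emb_tpoly W) (tact M) X.

Section UH.
Variable J : ideal L.
Variable X : tsubmod (tstau (constLinf W)).

(* Since exp_M maps Lie_M(X) to E_M(X) for X = L_infty<tau> and its dagger version,
   unit_mod and class_mod below are the kernel and the cokernel of the map
   Lie_M(X) -> E_M(X) / E_M(J[tau]) induced by exp_M. Their definitions do not rely
   on that inclusion. *)
Definition U_pred : {pred LieM_in X} :=
  fun f => expM (val f) \in hom_in_pred (polyJ W J).
Lemma U_submod : submod_closed U_pred.
Proof.
have [h0 hl] := hom_in_submod (emb_tpoly W) (tact M) (polyJ W J).
split=> [|p f g]; rewrite !unfold_in; first by rewrite !linear0.
by move=> hf hg; rewrite !linearP; apply: hl.
Qed.
HB.instance Definition _ := GRing.isSubmodClosed.Build {poly A} (LieM_in X) U_pred U_submod.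

Definition H_pred : {pred EM_in X} := fun g =>
  `[< exists (f : LieM_in X) (k : EM_in (polyJ W J)), val g = expM (val f) + val k >].
Lemma H_submod : submod_closed H_pred.
Proof.
split=> [|p g g']; rewrite !unfold_in.
  by apply/asboolP; exists 0, 0; rewrite !linear0 addr0.
move=> /asboolP[f [k e1]] /asboolP[f' [k' e2]]; apply/asboolP.
exists (p *: f + f'), (p *: k + k'); rewrite !linearP /= -!/(val _) e1 e2.
by rewrite scalerDr addrACA.
Qed.
HB.instance Definition _ := GRing.isSubmodClosed.Build {poly A} (EM_in X) H_pred H_submod.
End UH.

Record U_type J X := UType { U_val : LieM_in X; _ : U_val \in @U_pred J X }.
HB.instance Definition _ J X := [isSub for @U_val J X].
HB.instance Definition _ J X := [Choice of U_type J X by <:].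
HB.instance Definition _ J X := [SubChoice_isSubLmodule of U_type J X by <:].
Definition unit_mod J X : lmodType {poly A} := U_type J X.
Definition class_mod J X : lmodType {poly A} := quot (@H_pred J X).

Section Inclusion.
Variables (J : ideal L) (X Y : tsubmod (tstau (constLinf W))).
Hypothesis XY : forall x, X x -> Y x.
Lemma incl_Lie_subproof (f : LieM_in X) : hom_of f \in hom_in_pred Y.
Proof. by case: f => f /= /asboolP h; apply/asboolP=> v; apply/XY. Qed.
Definition incl_Lie (f : LieM_in X) : LieM_in Y := HomIn (incl_Lie_subproof f).
Lemma incl_E_subproof (f : EM_in X) : hom_of f \in hom_in_pred Y.
Proof. by case: f => f /= /asboolP h; apply/asboolP=> v; apply/XY. Qed.
Definition incl_E (f : EM_in X) : EM_in Y := HomIn (incl_E_subproof f).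
Lemma incl_Lie_is_linear : linear incl_Lie.
Proof.
move=> p f g; apply/val_inj.
exact: etrans (linearP val p f g) (esym (linearP val p (incl_Lie f) (incl_Lie g))).
Qed.
Lemma incl_E_is_linear : linear incl_E.
Proof.
move=> p f g; apply/val_inj.
exact: etrans (linearP val p f g) (esym (linearP val p (incl_E f) (incl_E g))).
Qed.

Lemma u_subproof (f : unit_mod J X) : incl_Lie (U_val f) \in @U_pred J Y.
Proof. by case: f. Qed.
Definition u_fun (f : unit_mod J X) : unit_mod J Y := UType (u_subproof f).
Lemma u_is_linear : linear u_fun.
Proof.
move=> p f g; apply/val_inj; rewrite linearP.
by rewrite -[LHS]/(incl_Lie (val (p *: f + g))) linearP incl_Lie_is_linear.
Qed.
HB.instance Definition _ := GRing.isLinear.Build {poly A} (unit_mod J X) (unit_mod J Y) _ u_fun u_is_linear.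
Definition u_map : {linear unit_mod J X -> unit_mod J Y} := u_fun.

Definition h_fun (x : class_mod J X) : class_mod J Y := qpi (@H_pred J Y) (incl_E (repr (x : quot (@H_pred J X)))).
Lemma h_funE g : h_fun (qpi (@H_pred J X) g) = qpi (@H_pred J Y) (incl_E g).
Proof.
apply/qpiP; set g' := repr _; have := qrepr (@H_pred J X) g; rewrite -/g' !unfold_in.
move=> /asboolP[f [k E]]; apply/asboolP; exists (incl_Lie f), k.
by rewrite -E.
Qed.
Lemma h_is_linear : linear h_fun.
Proof.
move=> p; elim/qpiW=> x; elim/qpiW=> y.
by rewrite -linearP !h_funE incl_E_is_linear linearP.
Qed.
HB.instance Definition _ := GRing.isLinear.Build {poly A} (class_mod J X) (class_mod J Y) _ h_fun h_is_linear.
Definition h_map : {linear class_mod J X -> class_mod J Y} := h_fun.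
End Inclusion.
End Maps.
End Exponential.
End Motives.

Section NaturalMaps.
Variables (F : finFieldType) (C : pointed_curve F) (L : fieldExtType C).
Variables (RR : realType) (V : completion C RR) (W : ext_completion L V).
Variables (M : tmodule L) (e : exponential M) (J : ideal L).

Definition UM : lmodType {poly coord_ring C} := unit_mod e J (tate W).
Definition UM_dagger : lmodType {poly coord_ring C} := unit_mod e J (dagger W).
Definition HM : lmodType {poly coord_ring C} := class_mod e J (tate W).
Definition HM_dagger : lmodType {poly coord_ring C} := class_mod e J (dagger W).
Definition uM : {linear UM_dagger -> UM} := u_map e J (@dagger_tate _ _ _ _ _ W).
Definition hM : {linear HM_dagger -> HM} := h_map e J (@dagger_tate _ _ _ _ _ W).
End NaturalMaps.

(* Main.v *)
From mathcomp Require Import all_boot all_order all_algebra all_field.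
From mathcomp Require Import boolp classical_sets reals topology normedtype sequences.
Require Import Defs.
From mathcomp Require Import ring lra zify.
Set Implicit Arguments.
Unset Strict Implicit.
Unset Printing Implicit Defensive.
Import Order.TTheory GRing.Theory Num.Theory.
Import numFieldNormedType.Exports.
Local Open Scope ring_scope.

(** A basis of M_L of rank d identifies Lie_M(X) and E_M(X) with X^d, and exp_M
    with left multiplication by the matrix of series exp = Id + sum_n e_n tau^n.
    The theorem then follows from two facts on vectors of series:
    - [overconv_of_image]: if y converges on the unit disc and exp y overconverges,
      then y overconverges.  As polynomials overconverge, this gives the surjectivity
      of u, and also the injectivity of h: if g = exp f + k with g and k
      overconvergent, then so is f.
    - [image_add_dagger]: every convergent z is exp y plus a polynomial, with y
      convergent.  This gives the surjectivity of h.
    The map u is injective because it is an inclusion.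

    Both facts are contraction arguments.  The equation z = exp y reads
      z_n = y_n + sum_(1 <= k <= n) e_k y_(n-k)^(q^k)
    on coefficients.  When |y_m| <= c with c small compared with the e_k, the term
    e_k y_m^(q^k) has norm at most |y_m| / 2; when m stays bounded and k is large, it
    is small because e_k tends to 0 very fast.  In the first case the estimate is run
    for |y_m| rho^(q^m) with rho > 1 close to 1; in the second one the equation is
    solved recursively for the tail of z, whose coefficients are at most c.

    That |e_n| s^(q^n) tends to 0 for every s is [expW_entire].  Take a in A with
    |a| > 1.  As dphi(a) - a is nilpotent, dphi(a^(p^n)) is the scalar a^(p^n) for n
    large; renaming this power a, the functional equation of exp becomes
      (a^(q^n) - a) e_n = sum_(l >= 1) phi_l e_(n-l)^(q^l),
    where l is bounded by the degree of phi(a), and the factor |a|^(q^n) on the left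
    forces the decay of e_n ([entire_growth]).

    The existence of a, that is, of a nonconstant function regular outside infinity, is
    [exists_pole_only_at]; it is obtained without Riemann-Roch.  Let y have a pole at
    infinity.  Since K is finite over F(y), a function v exists that is a unit at
    infinity and vanishes at all the other poles of y ([separating_unit]); then
    w = v^k y has, for k large, a pole at infinity and no other pole among those of y
    ([pole_among_T]).  By partial fractions, K is the sum of a finite-dimensional
    space, of the functions regular where y is, and of those regular at the poles of y
    ([regular_decomposition]).  So some nonconstant polynomial in w, without constant
    term, is a sum a + o of functions of the last two kinds, and a is the function
    sought. *)

(** * Linear dependence over F[y] in a function field *)
Section Dependence.
Variables (F K : fieldType) (iota : {rmorphism F -> K}).
Implicit Types (x y z : K) (p : {poly F}).

Definition evalF y p : K := (map_poly iota p).[y].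
Local Notation ev := evalF.

Lemma evD y p r : ev y (p + r) = ev y p + ev y r.
Proof. by rewrite /evalF rmorphD hornerD. Qed.
Lemma evM y p r : ev y (p * r) = ev y p * ev y r.
Proof. by rewrite /evalF rmorphM hornerM. Qed.
Lemma evC y c : ev y c%:P = iota c.
Proof. by rewrite /evalF map_polyC hornerC. Qed.
Lemma evX y : ev y 'X = y.
Proof. by rewrite /evalF map_polyX hornerX. Qed.
Lemma ev0 y : ev y 0 = 0.
Proof. by rewrite /evalF rmorph0 horner0. Qed.
Lemma evXn y n : ev y 'X^n = y ^+ n.
Proof. by rewrite /evalF map_polyXn hornerXn. Qed.
Lemma ev_sum y I (r : seq I) (P : pred I) (f : I -> {poly F}) :
  ev y (\sum_(i <- r | P i) f i) = \sum_(i <- r | P i) ev y (f i).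
Proof. exact: (big_morph (ev y) (evD y) (ev0 y)). Qed.
Lemma ev_coef y p : ev y p = \sum_(k < size p) iota p`_k * y ^+ k.
Proof.
rewrite /evalF horner_coef size_map_poly.
by apply: eq_bigr => k _; rewrite coef_map.
Qed.
Lemma ev_poly y N (f : nat -> F) :
  ev y (\poly_(k < N) f k) = \sum_(k < N) iota (f k) * y ^+ k.
Proof.
rewrite poly_def ev_sum; apply: eq_bigr => k _.
by rewrite -mul_polyC evM evC evXn.
Qed.

Lemma ev_cst y p : exists r, ev y p = iota p`_0 + y * ev y r.
Proof.
elim/poly_ind: p => [|p c _]; first by exists 0; rewrite ev0 coef0 rmorph0 mulr0 addr0.
exists p; rewrite evD evM evC evX -cons_poly_def coef_cons /=.
by rewrite addrC mulrC.
Qed.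

(** The polynomial T^D p(1/T), which moves a computation at a pole of y to one at a
    zero of T = 1/y; see [ev_rev]. *)
Definition revpoly (D : nat) p : {poly F} := \poly_(k < D.+1) p`_(D - k).

Lemma ev_rev y D p : y != 0 -> (size p <= D.+1)%N ->
  ev y p = y ^+ D * ev y^-1 (revpoly D p).
Proof.
move=> y0 sp; rewrite ev_poly mulr_sumr.
have -> : p = \poly_(k < D.+1) p`_k.
  apply/polyP=> k; rewrite coef_poly; case: ltnP => // /(leq_trans sp).
  exact: nth_default.
rewrite ev_poly (reindex_inj rev_ord_inj) /=; apply: eq_bigr => k _.
rewrite subSS coef_poly ltnS leq_subr mulrCA; congr (_ * _).
by rewrite exprVn -exprB ?unitfE // -ltnS ltn_ord.
Qed.

Lemma linear_dependence (I J : finType) (c : I -> J -> F) : (#|J| < #|I|)%N ->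
  exists2 u : I -> F, (exists i, u i != 0) & forall j, \sum_i u i * c i j = 0.
Proof.
move=> JI.
pose A := \matrix_(i < #|I|, j < #|J|) c (enum_val i) (enum_val j).
have : kermx A != 0.
  rewrite -mxrank_eq0 mxrank_ker subn_eq0 -ltnNge.
  exact: leq_ltn_trans (rank_leq_col A) JI.
move=> /rowV0Pn[v /sub_kermxP vA v0].
exists (fun i => v 0 (enum_rank i)) => [|j].
  have /matrix0Pn[k [i vi]] := v0; exists (enum_val i).
  by rewrite enum_valK -(ord1 k).
have /matrixP/(_ 0 (enum_rank j)) := vA; rewrite !mxE => E.
rewrite -[RHS]E (reindex (@enum_val I I)) /=; last exact: onW_bij (enum_val_bij I).
by apply: eq_bigr => i _; rewrite mxE enum_valK enum_rankK.
Qed.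

Lemma span_dependence (I J : finType) (c : I -> J -> F) (v : I -> K) (w : J -> K) :
  (#|J| < #|I|)%N -> (forall i, v i = \sum_j iota (c i j) * w j) ->
  exists2 u : I -> F, (exists i, u i != 0) & \sum_i iota (u i) * v i = 0.
Proof.
move=> JI vE; have [u u0 uc] := linear_dependence c JI; exists u => //.
under eq_bigr => i _ do rewrite vE mulr_sumr.
rewrite exchange_big big1 //= => j _.
under eq_bigr => i _ do rewrite mulrA -rmorphM.
by rewrite -mulr_suml -rmorph_sum uc rmorph0 mul0r.
Qed.

(** Bounds the degree of K over F(y) without mentioning F(y): coefficients are
    polynomials in y, and y may be algebraic over F. *)
Definition rank_lt y N := forall z : 'I_N -> K, exists2 p : 'I_N -> {poly F},
  (exists i, p i != 0) & \sum_i ev y (p i) * z i = 0.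

(** The space of the combinations of the b_j with coefficients polynomials in x of
    bounded degree; it has finite dimension over F, which allows counting. *)
Definition bounded_comb n (b : 'I_n -> K) x s z := exists2 p : 'I_n -> {poly F},
  (forall j, size (p j) <= s)%N & z = \sum_j ev x (p j) * b j.

Lemma bounded_comb_sum n (b : 'I_n -> K) x s I (r : seq I) (f : I -> K) :
  (forall i, bounded_comb b x s (f i)) -> bounded_comb b x s (\sum_(i <- r) f i).
Proof.
move=> h; elim: r => [|i r [p hp e]].
  exists (fun=> 0) => [j|]; first by rewrite size_poly0.
  by rewrite big_nil big1 // => j _; rewrite ev0 mul0r.
have [p' hp' e'] := h i; exists (fun j => p' j + p j) => [j|].
  by rewrite (leq_trans (size_polyD _ _)) // geq_max hp hp'.
rewrite big_cons e e' -big_split; apply: eq_bigr => j _ /=.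
by rewrite evD mulrDl.
Qed.
Lemma bounded_combM n (b : 'I_n -> K) x s d p z : (size p <= d)%N ->
  bounded_comb b x s z -> bounded_comb b x (d + s) (ev x p * z).
Proof.
move=> pd [r hr ->]; exists (fun j => p * r j) => [j|].
  rewrite (leq_trans (size_polyMleq _ _)) //.
  by rewrite (leq_trans (leq_pred _)) // leq_add.
by rewrite mulr_sumr; apply: eq_bigr => j _; rewrite evM mulrA.
Qed.

Lemma bounded_comb_le n (b : 'I_n -> K) x s s' z : (s <= s')%N ->
  bounded_comb b x s z -> bounded_comb b x s' z.
Proof. by move=> ss [p hp ->]; exists p => // j; rewrite (leq_trans (hp j)). Qed.

Lemma common_denominator n (b : 'I_n -> K) x (I : finType) (z : I -> K) :
  (forall i, exists (d : {poly F}) (p : 'I_n -> {poly F}),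
    d != 0 /\ ev x d * z i = \sum_j ev x (p j) * b j) ->
  exists2 d : {poly F}, d != 0 & exists s, forall i, bounded_comb b x s (ev x d * z i).
Proof.
move=> /choice[d /choice[p h]].
have d0 i : d i != 0 by case: (h i).
exists (\prod_i d i); first by apply/prodf_neq0 => i _.
have hi i : exists s, bounded_comb b x s (ev x (\prod_i d i) * z i).
  have [_ e] := h i; rewrite (bigD1 i) //= evM mulrAC e mulrC.
  exists (size (\prod_(j | j != i) d j)%R + \max_j size (p i j))%N.
  apply: bounded_combM => //; exists (p i) => // j.
  exact: (leq_bigmax j).
have [s hs] := choice hi; exists (\max_i s i)%N => i.
by apply: bounded_comb_le (hs i); apply: (leq_bigmax i).
Qed.

(** Finiteness over F(x) implies finiteness over F(y).  Some multiple
    d0(x) y of y raises the degree in x of the combinations of the n generators b_j by at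
    most c'.  So, up to a common factor, the products y^k z_i with k <= M and
    i <= n c' lie in a space of dimension n (M c' + s) over F, and there are
    (n c' + 1) (M + 1) of them: for M large they are linearly dependent over F. *)
Lemma exists_rank_bound n (b : 'I_n -> K) x :
  (forall z, exists (d : {poly F}) (p : 'I_n -> {poly F}),
    (d != 0 /\ ev x d * z = \sum_j ev x (p j) * b j)) ->
  (forall p, p != 0 -> ev x p != 0) ->
  forall y, exists N, rank_lt y N.
Proof.
move=> gen x0 y.
have [d0 d0n [c hc]] := common_denominator (fun j => gen (y * b j)).
pose c' := maxn c (size d0).
have hy s z : bounded_comb b x s z -> bounded_comb b x (c' + s) (ev x d0 * y * z).
  case=> p hp ->; rewrite mulr_sumr; apply: bounded_comb_sum => j.
  have -> : ev x d0 * y * (ev x (p j) * b j) = ev x (p j) * (ev x d0 * (y * b j)) by ring.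
  rewrite addnC; apply: bounded_combM; first exact: hp.
  by apply: bounded_comb_le (hc j); rewrite leq_maxl.
have hd s z : bounded_comb b x s z -> bounded_comb b x (c' + s) (ev x d0 * z).
  by apply: bounded_combM; rewrite leq_maxr.
have hk M k s z : (k <= M)%N -> bounded_comb b x s z ->
    bounded_comb b x (M * c' + s) (ev x d0 ^+ M * y ^+ k * z).
  move=> kM hz; elim: M k kM => [|M ih] k kM.
    by move: kM; rewrite leqn0 => /eqP ->; rewrite mul1r mul1r.
  case: k kM => [|k] kM.
    have := hd _ _ (ih 0%N isT); rewrite mulSn -addnA.
    by rewrite exprS !mulrA.
  have := hy _ _ (ih k kM); rewrite mulSn -addnA.
  by congr bounded_comb; rewrite !exprS; ring.
exists (n * c').+1 => z.
have [d dn [s hs]] := common_denominator (fun i => gen (z i)).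
(* this M makes n (M c' + s) < (n c' + 1) (M + 1) *)
pose M := (n * s)%N; pose S := (M * c' + s)%N.
have hv (ik : 'I_(n * c').+1 * 'I_M.+1) : exists p : 'I_n -> {poly F},
    (forall j, (size (p j) <= S)%N) /\
    ev x d0 ^+ M * ev x d * (y ^+ ik.2 * z ik.1) = \sum_j ev x (p j) * b j.
  have [p hp e] := hk M ik.2 s _ (leq_ord _) (hs ik.1); exists p; split=> //.
  by rewrite -e; ring.
have [p hp] := choice hv.
have [||u [[i0 k0] u0] e] := @span_dependence ('I_(n * c').+1 * 'I_M.+1)%type
    ('I_n * 'I_S)%type (fun ik js => (p ik js.1)`_js.2)
    (fun ik => ev x d0 ^+ M * ev x d * (y ^+ ik.2 * z ik.1))
    (fun js => x ^+ js.2 * b js.1).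
- by rewrite !card_prod !card_ord /S /M; nia.
- move=> ik; have [sp ->] := hp ik.
  rewrite -(pair_bigA _ (fun (j : 'I_n) (t : 'I_S) => iota (p ik j)`_t * (x ^+ t * b j))) /=.
  apply: eq_bigr => j _.
  have -> : p ik j = \poly_(k < S) (p ik j)`_k.
    apply/polyP=> k; rewrite coef_poly; case: ltnP => // /(leq_trans (sp j)).
    exact: nth_default.
  rewrite ev_poly mulr_suml; apply: eq_bigr => k _.
  by rewrite coef_poly ltn_ord mulrA.
exists (fun i => \poly_(k < M.+1) u (i, inord k)).
  exists i0; apply: contraNneq u0 => /polyP/(_ k0).
  by rewrite coef_poly ltn_ord inord_val coef0 => ->.
apply: (mulfI (_ : ev x d0 ^+ M * ev x d != 0)).
  by rewrite mulf_neq0 ?expf_neq0 ?x0.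
transitivity (\sum_(i : 'I_(n * c').+1) \sum_(k : 'I_M.+1) iota (u (i, k)) *
    (ev x d0 ^+ M * ev x d * (y ^+ k * z i))); last first.
  by rewrite pair_bigA mulr0 -[RHS]e; apply: eq_bigr => -[].
rewrite mulr_sumr.
apply: eq_bigr => i _; rewrite ev_poly mulr_suml mulr_sumr.
apply: eq_bigr => k _; rewrite inord_val; ring.
Qed.
End Dependence.

(** * Places, and functions with a single pole *)
Section Places.
Variables (F : finFieldType) (K : fieldType) (iota : {rmorphism F -> K}).
Implicit Types (x y z t : K) (p : {poly F}) (O : set K).
Local Notation ev := (evalF iota).
Local Notation place := (is_place iota).

(** The maximal ideal of the valuation ring O. *)
Definition pmax O x : Prop := O x /\ (x != 0 -> ~ O x^-1).

Section OnePlace.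
Variables (O : set K) (hO : place O).
Lemma place_cst c : O (iota c). Proof. by case: hO. Qed.
Lemma placeB x y : O x -> O y -> O (x - y). Proof. by case: hO => _ h _ _ _; apply: h. Qed.
Lemma placeM x y : O x -> O y -> O (x * y). Proof. by case: hO => _ _ h _ _; apply: h. Qed.
Lemma placeV x : O x \/ O x^-1. Proof. by case: hO. Qed.
Lemma place0 : O 0. Proof. by have := place_cst 0; rewrite rmorph0. Qed.
Lemma place1 : O 1. Proof. by have := place_cst 1; rewrite rmorph1. Qed.
Lemma placeN x : O x -> O (- x).
Proof. by move=> hx; rewrite -sub0r; apply: placeB => //; exact: place0. Qed.
Lemma placeD x y : O x -> O y -> O (x + y).
Proof. by move=> hx hy; rewrite -[y]opprK; apply: placeB => //; exact: placeN. Qed.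
Lemma placeX x n : O x -> O (x ^+ n).
Proof.
by move=> hx; elim: n => [|n ih]; [exact: place1|rewrite exprS; exact: placeM].
Qed.
Lemma place_sum I (r : seq I) (P : pred I) (f : I -> K) :
  (forall i, P i -> O (f i)) -> O (\sum_(i <- r | P i) f i).
Proof. by move=> h; elim/big_ind: _ => //; [exact: place0|exact: placeD]. Qed.
Lemma place_ev y p : O y -> O (ev y p).
Proof.
move=> hy; rewrite ev_coef; apply: place_sum => k _.
by apply: placeM; [exact: place_cst|exact: placeX].
Qed.

Lemma pmax_O x : pmax O x -> O x. Proof. by case. Qed.
Lemma pmax0 : pmax O 0. Proof. by split; [exact: place0|rewrite eqxx]. Qed.
Lemma pmax1 : ~ pmax O 1.
Proof. by case=> _ /(_ (oner_neq0 _)); rewrite invr1; apply; exact: place1. Qed.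
Lemma pmaxM z x : O z -> pmax O x -> pmax O (z * x).
Proof.
move=> hz [hx nx]; split; first exact: placeM.
rewrite mulf_eq0 negb_or => /andP[z0 x0] h; apply: (nx x0).
by have := placeM hz h; rewrite invfM mulrA divff // mul1r.
Qed.
Lemma pmaxN x : pmax O x -> pmax O (- x).
Proof. by rewrite -mulN1r => h; apply: pmaxM => //; apply/placeN/place1. Qed.
Lemma pmaxD x y : pmax O x -> pmax O y -> pmax O (x + y).
Proof.
move=> hx hy.
have [->|x0] := eqVneq x 0; first by rewrite add0r.
have [->|y0] := eqVneq y 0; first by rewrite addr0.
have [h|h] := placeV (x / y).
  have -> : x + y = (x / y + 1) * y by rewrite mulrDl divfK // mul1r.
  by apply: pmaxM => //; apply: placeD => //; exact: place1.
rewrite invf_div in h.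
have -> : x + y = (1 + y / x) * x by rewrite mulrDl divfK // mul1r.
by apply: pmaxM => //; apply: placeD => //; exact: place1.
Qed.
Lemma pmaxB x y : pmax O x -> pmax O y -> pmax O (x - y).
Proof. by move=> hx hy; apply: pmaxD => //; exact: pmaxN. Qed.
Lemma pmax_sum I (r : seq I) (P : pred I) (f : I -> K) :
  (forall i, P i -> pmax O (f i)) -> pmax O (\sum_(i <- r | P i) f i).
Proof. by move=> h; elim/big_ind: _ => //; [exact: pmax0|exact: pmaxD]. Qed.
Lemma place_unit x : O x -> ~ pmax O x -> x != 0 /\ O x^-1.
Proof.
move=> hx nx; have x0 : x != 0 by apply/eqP => e; apply: nx; rewrite e; exact: pmax0.
by split=> //; apply: contrapT => h; apply: nx; split.
Qed.
Lemma unit_pmax x : x != 0 -> O x^-1 -> ~ pmax O x.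
Proof. by move=> x0 h [_ /(_ x0)]. Qed.
Lemma notin_pmax x : ~ O x -> x != 0 /\ pmax O x^-1.
Proof.
move=> hx; have x0 : x != 0 by apply/eqP => e; apply: hx; rewrite e; exact: place0.
by split=> //; split; [case: (placeV x)|rewrite invrK].
Qed.
Lemma pmax_prime x y : O x -> O y -> pmax O (x * y) -> ~ pmax O x -> pmax O y.
Proof.
move=> hx hy hxy nx; have [x0 xV] := place_unit hx nx.
by have := pmaxM xV hxy; rewrite mulKf.
Qed.
Lemma pmaxX x n : O x -> pmax O (x ^+ n) -> pmax O x.
Proof.
move=> hx; elim: n => [/pmax1//|n ih]; rewrite exprS => h.
by apply: contrapT => nx; apply: (nx); apply: ih; apply: pmax_prime h nx => //; exact: placeX.
Qed.
Lemma pmax_cst c : c != 0 -> ~ pmax O (iota c).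
Proof.
move=> c0; apply: unit_pmax; first by rewrite fmorph_eq0.
by rewrite -fmorphV; exact: place_cst.
Qed.
Lemma unitD x y : O x -> ~ pmax O x -> pmax O y -> ~ pmax O (x + y).
Proof. by move=> hx nx hy h; apply: nx; rewrite -(addrK y x); apply: pmaxB. Qed.

Lemma ev_pmax t p : pmax O t -> pmax O (ev t p - iota p`_0).
Proof.
move=> ht; have [r ->] := ev_cst iota t p.
rewrite addrAC subrr add0r mulrC; apply: pmaxM => //.
by apply: place_ev; apply: pmax_O.
Qed.
Lemma ev_unit t p : pmax O t -> p`_0 != 0 -> ~ pmax O (ev t p).
Proof.
move=> ht p0; rewrite -(subrK (iota p`_0) (ev t p)) addrC.
by apply: unitD; [exact: place_cst|exact: pmax_cst|exact: ev_pmax].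
Qed.

(** At a pole of z the leading term of p(z) dominates. *)
Lemma ev_pole z p : ~ O z -> p != 0 ->
  exists2 u, O u /\ ~ pmax O u & ev z p = u * z ^+ (size p).-1.
Proof.
move=> hz p0; have [z0 zm] := notin_pmax hz.
exists (ev z^-1 (revpoly (size p).-1 p)).
  split; first by apply: place_ev; apply: pmax_O.
  apply: ev_unit => //; rewrite coef_poly /= subn0.
  by rewrite -/(lead_coef p) lead_coef_eq0.
by rewrite mulrC -ev_rev // leqSpred.
Qed.
Lemma ev_notin z p : ~ O z -> (1 < size p)%N -> ~ O (ev z p).
Proof.
move=> hz sp; have p0 : p != 0 by rewrite -size_poly_gt0; exact: ltnW.
have [u [uO nu] ->] := ev_pole hz p0.
have [u0 uV] := place_unit uO nu; have [z0 zm] := notin_pmax hz.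
case: (size p) sp => [|[|n]] //= _ h.
have := placeM uV h; rewrite mulKf // exprSr => h'.
have := placeM (placeX n (pmax_O zm)) h'.
by rewrite mulrA -exprMn mulVf // expr1n mul1r.
Qed.

Lemma integral_place n (a : 'I_n -> K) x : (forall i, O (a i)) ->
  x ^+ n = \sum_(i < n) a i * x ^+ i -> O x.
Proof.
move=> ha e; apply: contrapT => hx; have [x0 xm] := notin_pmax hx.
apply: pmax1; rewrite -(divff (expf_neq0 n x0)) {1}e mulr_suml.
apply: pmax_sum => i _; rewrite -mulrA; apply: pmaxM; first exact: ha.
have -> : x ^+ i / x ^+ n = x^-1 ^+ (n - i).
  have -> : x ^+ n = x ^+ i * x ^+ (n - i) by rewrite -exprD subnKC // ltnW.
  rewrite invfM mulrA divff ?expf_neq0 //.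
  by rewrite mul1r exprVn.
have : (0 < n - i)%N by rewrite subn_gt0.
case: (n - i)%N => // m _.
by rewrite exprSr; apply: pmaxM => //; apply/placeX/pmax_O.
Qed.
End OnePlace.

Lemma place_ext O O' : (forall x, O x <-> O' x) -> O = O'.
Proof. by move=> h; apply/funext => x; apply/propext. Qed.

Section PoleAtInfinity.
Variables (N : nat) (y : K).
Hypothesis (rankN : rank_lt iota y N).
Variables (Oi : set K) (hOi : place Oi) (yOi : ~ Oi y).
Local Notation T := (y^-1).

Lemma y_neq0 : y != 0. Proof. by case: (notin_pmax hOi yOi). Qed.
Lemma T_pmax : pmax Oi T. Proof. by case: (notin_pmax hOi yOi). Qed.
Lemma T_neq0 : T != 0. Proof. by rewrite invr_eq0 y_neq0. Qed.
Lemma evy_neq0 p : p != 0 -> ev y p != 0.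
Proof.
move=> p0; have [u [uO nu] ->] := ev_pole hOi yOi p0.
have [u0 _] := place_unit hOi uO nu.
by rewrite mulf_neq0 // expf_neq0 // y_neq0.
Qed.

(** Multiplying a dependence relation over F[y] by T^D, with D its degree, turns
    it into a relation over F[T] whose coefficients do not all vanish at T = 0: their
    constant terms are the coefficients of y^D.  The relation can thus be reduced at
    every pole of y. *)
Lemma primitive_dependence (z : 'I_N -> K) :
  exists2 s : 'I_N -> {poly F}, (exists i, (s i)`_0 != 0) & \sum_i ev T (s i) * z i = 0.
Proof.
have [p [i0 pi0] e] := rankN z.
have N0 : (0 < #|'I_N|)%N by apply/card_gt0P; exists i0.
have [i1 hi1] := @bigop.eq_bigmax 'I_N (fun i => size (p i)) N0.
(* the largest degree of the coefficients in y *)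
pose D := (size (p i1)).-1.
have pi1 : p i1 != 0.
  rewrite -size_poly_gt0 -hi1; apply: leq_trans (leq_bigmax i0).
  by rewrite lt0n size_poly_eq0.
exists (fun i => revpoly D (p i)).
  by exists i1; rewrite coef_poly /= subn0 -/(lead_coef _) lead_coef_eq0.
apply: (mulfI (expf_neq0 D y_neq0)); rewrite mulr0 -[RHS]e mulr_sumr.
apply: eq_bigr => i _; rewrite mulrA -ev_rev ?y_neq0 //.
apply: leq_trans (leqSpred _); rewrite -hi1; exact: (leq_bigmax i).
Qed.

Lemma first_nonzero (s : 'I_N -> {poly F}) : (exists i, (s i)`_0 != 0) ->
  exists2 k, (s k)`_0 != 0 & forall i : 'I_N, (i < k)%N -> (s i)`_0 = 0.
Proof.
move=> [i0 h0].
have [k hk mink] := @arg_minnP _ i0 (fun i => (s i)`_0 != 0) (fun i => i : nat) h0.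
exists k => // i ik; apply/eqP; apply: contraTT ik => h.
by rewrite -leqNgt; apply: mink.
Qed.

Lemma ev_zero_cst (s : {poly F}) O : place O -> pmax O T -> s`_0 = 0 -> pmax O (ev T s).
Proof. by move=> hO hT s0; have := ev_pmax hO s hT; rewrite s0 rmorph0 subr0. Qed.

(** The residue fields at the poles of y are algebraic over F, and one polynomial
    serves for all these places: reduce a relation between the powers of z. *)
Lemma residue_algebraic z : exists2 p, p != 0 &
  forall O, place O -> pmax O T -> O z -> pmax O (ev z p).
Proof.
have [s [i0 si0] e] := primitive_dependence (fun i : 'I_N => z ^+ i).
exists (\sum_(i < N) (s i)`_0 *: 'X^i).
  apply: contraNneq si0 => /polyP/(_ i0); rewrite coef_sum coef0.
  rewrite (bigD1 i0) //= coefZ coefXn eqxx mulr1 big1 ?addr0 => [->//|i ii0].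
  by rewrite coefZ coefXn eq_sym (negPf (ii0 : (i : nat) != i0)) mulr0.
move=> O hO hT hz; rewrite ev_sum -[X in pmax O X]subr0 -[X in _ - X]e -sumrB.
apply: pmax_sum => // i _; rewrite -mul_polyC evM evC evXn -mulrBl mulrC.
apply: pmaxM => //; first exact: placeX.
by rewrite -opprB; apply: pmaxN => //; apply: ev_pmax.
Qed.

(** There is no inclusion between two distinct places of a function field.  If
    z has a pole at Oi but not at O, then the value at z of the polynomial of
    [residue_algebraic] vanishes at O, while its inverse lies in Oi, hence in O. *)
Lemma place_maximal O : place O -> pmax O T -> (forall z, Oi z -> O z) -> O = Oi.
Proof.
move=> hO hT sub; apply: place_ext => z; split=> [hz|]; last exact: sub.
apply: contrapT => nz; have [p p0 hp] := residue_algebraic z.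
have [u [uO nu] E] := ev_pole hOi nz p0.
have [u0 uV] := place_unit hOi uO nu.
have [z0 [zV _]] := notin_pmax hOi nz.
have [_] := hp O hO hT hz.
apply; first by rewrite E mulf_neq0 // expf_neq0.
by apply: sub; rewrite E invfM -exprVn; apply: placeM => //; apply: placeX.
Qed.

(** With p given by [residue_algebraic], e = 1 / (1 + u p(u)) takes the value 1
    at the poles of y where u is regular, and vanishes at those where u has a pole. *)
Lemma indicator u : exists e, forall O, place O -> pmax O T ->
  [/\ O e, O u -> ~ pmax O e & ~ O u -> pmax O e].
Proof.
have [p p0 hp] := residue_algebraic u.
exists (ev u ('X * p + 1%:P))^-1 => O hO hT.
have [hu|hu] := pselect (O u).
  have hD : ~ pmax O (ev u ('X * p + 1%:P)).
    rewrite evD evM evX evC rmorph1 addrC; apply: (unitD hO (place1 hO) (pmax1 hO)).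
    by apply: pmaxM => //; apply: hp.
  have [D0 DV] := place_unit hO (place_ev hO _ hu) hD.
  split=> // _; apply: (unit_pmax); first by rewrite invr_eq0.
  by rewrite invrK; apply: place_ev.
have h : ~ O (ev u ('X * p + 1%:P)).
  apply: ev_notin => //; rewrite mulrC size_MXaddC (negPf p0) /=.
  by rewrite ltnS size_poly_gt0.
by have [_ h'] := notin_pmax hO h; split=> //; apply: pmax_O h'.
Qed.

(** Start from e = 1.  As long as e does not vanish at some pole Q of y other
    than Oi, multiply it by the [indicator] of a function regular at Oi but not at Q.
    If this never stopped, reducing at the place Q k a primitive relation between the
    successive functions e_i, with k the first index whose coefficient is nonzero at
    T = 0, would give a contradiction: e_i vanishes at Q k for i > k but not for i = k. *)
Lemma separating_unit : exists e, [/\ forall O, place O -> pmax O T -> O e,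
  ~ pmax Oi e & forall O, place O -> pmax O T -> O <> Oi -> pmax O e].
Proof.
apply: contrapT => hn.
pose good e := (forall O, place O -> pmax O T -> O e) /\ ~ pmax Oi e.
have step e : exists Of : set K * K, good e ->
    [/\ place Of.1 /\ pmax Of.1 T, forall O, place O -> pmax O T -> O Of.2,
      ~ pmax Of.1 e, good (e * Of.2) & pmax Of.1 (e * Of.2)].
  have [he|] := pselect (good e); last by exists (set0, 0).
  have : exists O, [/\ place O, pmax O T, O <> Oi & ~ pmax O e].
    apply: contrapT => h; apply: hn; exists e; case: he => h1 h2; split=> // O hO hT nO.
    by apply: contrapT => he; apply: h; exists O.
  move=> [O [hO hT nO ne]].
  have [u uOi uO] : exists2 u, Oi u & ~ O u.
    apply: contrapT => h; apply: nO; apply: place_maximal => // z zi.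
    by apply: contrapT => zO; apply: h; exists z.
  have [f hf] := indicator u; exists (O, f) => -[he1 he2] /=; split=> //.
  - by move=> O' hO' hT'; case: (hf O' hO' hT').
  - split=> [O' hO' hT'|h].
      by apply: placeM => //; [apply: he1|case: (hf O' hO' hT')].
    have [fO /(_ uOi) nf _] := hf Oi hOi T_pmax.
    by apply: nf; apply: pmax_prime h he2 => //; apply: he1 => //; exact: T_pmax.
  - have [fO _ /(_ uO) fm] := hf O hO hT.
    by apply: pmaxM => //; apply: he1.
have [Of hOf] := choice step.
pose e k := iter k (fun e => e * (Of e).2) 1.
have ge k : good (e k).
  elim: k => [|k ih]; last by rewrite /e iterS; case: (hOf _ ih).
  by split=> [O hO _|]; [exact: place1|exact: pmax1].
pose Q k := (Of (e k)).1.
have hQ k : place (Q k) /\ pmax (Q k) T by case: (hOf _ (ge k)).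
have nQ k : ~ pmax (Q k) (e k) by case: (hOf _ (ge k)).
have Qm k j : (k < j)%N -> pmax (Q k) (e j).
  have [hO hT] := hQ k.
  elim: j => // j ih; rewrite ltnS leq_eqVlt => /orP[/eqP<-|/ih h].
    by case: (hOf _ (ge k)).
  rewrite /e iterS -/(e j) mulrC; apply: pmaxM => //.
  by have [_ fO _ _ _] := hOf _ (ge j); apply: fO.
have [s s0 E] := primitive_dependence (fun i : 'I_N => e i).
have [k sk mk] := first_nonzero s0; have [hO hT] := hQ k.
have Oe j : Q k (e j) by case: (ge j) => h _; apply: h.
apply: (nQ k); apply: (pmax_prime hO (place_ev hO (s k) (pmax_O hT)) (Oe k)); last exact: ev_unit.
rewrite (bigD1 k) //= in E; rewrite -(addrK (\sum_(i < N | i != k) ev T (s i) * e i) (_ * _)) E sub0r.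
apply: pmaxN => //; apply: pmax_sum => // i ik.
have [ik'|ki] := ltnP i k.
  by rewrite mulrC; apply: pmaxM => //; apply: ev_zero_cst => //; apply: mk.
apply: pmaxM => //; first by apply: place_ev => //; apply: pmax_O.
by apply: Qm; rewrite ltn_neqAle ki andbT eq_sym.
Qed.

(** A primitive relation between the powers of e shows that some e^(k+1) is
    divisible by T at all the places over T where e vanishes, with the same k for all of
    them; then w = e^(k+1) / T. *)
Lemma pole_among_T : exists w, ~ Oi w /\ (forall O, place O -> O <> Oi -> pmax O T -> O w).
Proof.
have [e [eO ei em]] := separating_unit.
have [s s0 E] := primitive_dependence (fun i : 'I_N => e ^+ i.+1).
have [k sk mk] := first_nonzero s0.
exists (e ^+ k.+1 / T); split=> [h|O hO nO hT].
  have := pmaxM hOi h T_pmax; rewrite divfK ?T_neq0 //.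
  move=> h'; apply: ei; apply: (pmaxX hOi _ h'); apply: eO => //; exact: T_pmax.
have he := em O hO hT nO.
have Oev p : O (ev T p) by apply: place_ev => //; apply: pmax_O.
pose c := \sum_(i < N | (k < i)%N) ev T (s i) * e ^+ (i - k).
have cm : ~ pmax O (ev T (s k) + c).
  apply: unitD => //; first exact: ev_unit.
  apply: pmax_sum => // i ki; apply: pmaxM => //.
  have : (0 < i - k)%N by rewrite subn_gt0.
  case: (i - k)%N => // m _; rewrite exprSr; apply: pmaxM => //.
  by apply: placeX => //; apply: pmax_O.
have cO : O (ev T (s k) + c).
  apply: placeD => //; apply: place_sum => // i _; apply: placeM => //.
  by apply: placeX => //; apply: pmax_O.
have [c0 cV] := place_unit hO cO cm.
have -> : e ^+ k.+1 / T = (ev T (s k) + c)^-1 * ((ev T (s k) + c) * e ^+ k.+1 / T).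
  by rewrite !mulrA mulVf // mul1r.
apply: placeM => //.
have -> : (ev T (s k) + c) * e ^+ k.+1 = - \sum_(i < N | (i < k)%N) ev T (s i) * e ^+ i.+1.
  apply/eqP; rewrite -addr_eq0; apply/eqP; rewrite -[RHS]E.
  rewrite [RHS](bigID (fun i : 'I_N => (i < k)%N)) /= addrC; congr (_ + _).
  rewrite [RHS](bigD1 k) ?ltnn //= mulrDl; congr (_ + _).
  rewrite mulr_suml; apply: eq_big => [i|i ki].
    by rewrite -leqNgt ltn_neqAle eq_sym andbC.
  by rewrite -mulrA -exprD addnS subnK // ltnW.
rewrite mulNr mulr_suml; apply: placeN => //; apply: place_sum => // i ik.
have [r ->] := ev_cst iota T (s i); rewrite (mk i ik) rmorph0 add0r.
rewrite mulrAC [T * _]mulrC mulfK ?T_neq0 //; apply: placeM => //.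
by apply: placeX => //; apply: pmax_O.
Qed.

Lemma spanning_family : exists n (b : 'I_n -> K), forall z,
  exists (d : {poly F}) (p : 'I_n -> {poly F}),
    d != 0 /\ ev y d * z = \sum_j ev y (p j) * b j.
Proof.
have exN : exists N, `[< rank_lt iota y N >] by exists N; apply/asboolP.
case: (ex_minnP exN) => -[|n] /asboolP hN minN.
  by have [p [[]]] := hN (fun=> 0).
have /existsNP[b hb] : ~ rank_lt iota y n.
  by move=> /asboolP/minN; rewrite ltnn.
exists n, b => z.
pose zz := fun i : 'I_n.+1 => if unlift ord0 i is Some j then b j else z.
have [p p0 e] := hN zz.
rewrite big_ord_recl {1}/zz unlift_none /= in e.
have E : ev y (p ord0) * z = \sum_j ev y (- p (lift ord0 j)) * b j.
  apply/eqP; rewrite -subr_eq0 -sumrN -[X in _ == X]e; apply/eqP; congr (_ + _).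
  apply: eq_bigr => j _; rewrite /zz liftK -mulNr; congr (_ * _).
  by rewrite /evalF rmorphN hornerN opprK.
exists (p ord0), (fun j => - p (lift ord0 j)); split=> //.
apply/eqP => p00; apply: hb; exists (fun j => - p (lift ord0 j)); last first.
  by rewrite -E p00 ev0 mul0r.
case: p0 => i; case: (unliftP ord0 i) => [j ->|-> /eqP//] pj.
by exists j; rewrite oppr_eq0.
Qed.

Lemma evy_place O p m : place O -> O T -> (size p <= m.+1)%N -> O (ev y p * T ^+ m).
Proof.
move=> hO hT sp; rewrite (ev_rev iota y_neq0 sp) mulrAC -exprMn divff ?y_neq0 //.
by rewrite expr1n mul1r; apply: place_ev.
Qed.

(** For a suitable g the product g(y) b is integral over F[y], the leading
    coefficient of an equation of b being a possible g; then T^m g(y) b is integral over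
    F[T] for m large. *)
Lemma integral_multiple b : exists g m, g != 0 /\ forall O, place O ->
  (O y -> O (ev y g * b)) /\ (O T -> O (T ^+ m * (ev y g * b))).
Proof.
have [p [i0 pi0] e] := rankN (fun i : 'I_N => b ^+ i).
have [r hr maxr] := @arg_maxnP _ i0 (fun i => p i != 0) (fun i => i : nat) pi0.
pose g := p r.
have e1 : ev y g * b ^+ r = - \sum_(i < r) ev y (p (widen_ord (ltnW (ltn_ord r)) i)) * b ^+ i.
  apply/eqP; rewrite -addr_eq0 -[X in _ == X]e; apply/eqP.
  rewrite -(big_ord_narrow (F := fun i : 'I_N => ev y (p i) * b ^+ i) (ltnW (ltn_ord r))) /=.
  rewrite [RHS](bigD1 r) //=; congr (_ + _).
  rewrite big_mkcond [RHS]big_mkcond; apply: eq_bigr => i _ /=.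
  case: ltnP => [ir|ri]; first by rewrite -(inj_eq val_inj) /= neq_ltn ir.
  case: eqP => // /eqP ne; have [->|pi] := eqVneq (p i) 0; first by rewrite ev0 mul0r.
  by have /= := maxr i pi; rewrite -ltnS; move: ne; rewrite -(inj_eq val_inj) /=; lia.
have r0 : (0 < r)%N.
  rewrite lt0n; apply/eqP => r0; move: e1; rewrite big1 => [|[i ir] _]; last first.
    by exfalso; move: ir; rewrite r0.
  by rewrite r0 expr0 mulr1 oppr0 => /eqP; apply/negP; exact: evy_neq0.
pose a := fun i : 'I_r => - (p (widen_ord (ltnW (ltn_ord r)) i) * g ^+ (r - i.+1)).
have evXp q k : ev y (q ^+ k) = ev y q ^+ k.
  by elim: k => [|k ih]; rewrite ?expr0 -?polyC1 ?evC ?rmorph1 // !exprS evM ih.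
have evNp q : ev y (- q) = - ev y q by rewrite /evalF rmorphN hornerN.
(* the relation multiplied by g^(r-1), which makes it monic in g b *)
have e2 : (ev y g * b) ^+ r = \sum_i ev y (a i) * (ev y g * b) ^+ i.
  rewrite exprMn; have -> : ev y g ^+ r = ev y g ^+ r.-1 * ev y g by rewrite -exprSr prednK.
  rewrite -mulrA e1 mulrN mulr_sumr -sumrN; apply: eq_bigr => i _.
  rewrite /a evNp evM evXp mulNr exprMn; congr (- _).
  have -> : (r.-1 = (r - i.+1) + i)%N by have := ltn_ord i; lia.
  by rewrite exprD; ring.
pose m := \max_i size (a i).
exists g, m; split=> // O hO; split=> [hy|hT].
  by apply: integral_place e2 => // i; apply: place_ev.

(* a_i T^(m (r - i)) is regular where T is, since m is at least the degree of a_i *)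
have e3 : (T ^+ m * (ev y g * b)) ^+ r =
    \sum_(i < r) (ev y (a i) * T ^+ (m * (r - i))) * (T ^+ m * (ev y g * b)) ^+ i.
  rewrite exprMn e2 mulr_sumr; apply: eq_bigr => i _.
  rewrite [in RHS]exprMn -!exprM.
  have -> : (m * r = m * (r - i) + m * i)%N by have := ltn_ord i; nia.
  by rewrite exprD; ring.
apply: integral_place e3 => // i.
have -> : (m * (r - i) = m + m * (r - i.+1))%N by have := ltn_ord i; nia.
rewrite exprD mulrA; apply: placeM => //; last exact: placeX.
apply: evy_place => //; apply: leqW; exact: (leq_bigmax i).
Qed.

Lemma integral_family : exists n (b : 'I_n -> K) m,
  [/\ forall z, exists (d : {poly F}) (p : 'I_n -> {poly F}),
        d != 0 /\ ev y d * z = \sum_j ev y (p j) * b j,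
      forall O j, place O -> O y -> O (b j)
    & forall O j, place O -> O T -> O (T ^+ m * b j)].
Proof.
have [n [b hb]] := spanning_family.
have [g /choice[m h]] := choice (fun j => integral_multiple (b j)).
exists n, (fun j => ev y (g j) * b j), (\max_j m j)%N; split=> [z|O j hO hy|O j hO hT].
- have [d [p [d0 e]]] := hb z.
  exists (d * \prod_j g j), (fun j => p j * \prod_(i | i != j) g i); split.
    by rewrite mulf_neq0 //; apply/prodf_neq0 => i _; case: (h i).
  rewrite evM mulrAC e mulr_suml; apply: eq_bigr => j _.
  by rewrite (bigD1 j) //= !evM; ring.
- by have [_ /(_ O hO)[]] := h j; auto.
have [_ /(_ O hO)[_ /(_ hT) hj]] := h j.
have mj : (m j <= \max_j m j)%N by exact: (leq_bigmax j).
rewrite -(subnK mj) exprD -mulrA; apply: placeM => //; exact: placeX.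
Qed.

(** On the generators b_j of [integral_family], write a coefficient
    p(y) / d(y) as T^m times the quotient of y^m p by d, plus T^m r(y) / d(y), where r
    has smaller degree than d.  The last term is regular at the poles of y even after
    multiplication by b_j.  The first one is a polynomial in y plus a combination of
    T, ..., T^m, and these T^k b_j span the finite-dimensional part. *)
Lemma regular_decomposition : exists (J : finType) (v : J -> K), forall z,
  exists (c : J -> F) beta o,
  [/\ z = \sum_j iota (c j) * v j + beta + o,
      forall O, place O -> O y -> O beta
    & forall O, place O -> pmax O T -> O o].
Proof.
have [n [b [m [hb bB bT]]]] := integral_family.
exists (prod 'I_n 'I_m), (fun jk : 'I_n * 'I_m => T ^+ jk.2.+1 * b jk.1) => z.
have [d [p [d0 e]]] := hb z.
pose qj j := ('X^m * p j) %/ d; pose rj j := ('X^m * p j) %% d.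
have hz : z = \sum_j (T ^+ m * ev y (qj j) * b j + T ^+ m * (ev y (rj j) / ev y d) * b j).
  apply: (mulfI (evy_neq0 d0)); rewrite e mulr_sumr; apply: eq_bigr => j _.
  have E : y ^+ m * ev y (p j) = ev y (qj j) * ev y d + ev y (rj j).
    by rewrite -(evXn iota) -evM (divp_eq ('X^m * p j) d) evD evM.
  have -> : ev y (p j) = T ^+ m * (y ^+ m * ev y (p j)).
    by rewrite mulrA -exprMn mulVf ?y_neq0 // expr1n mul1r.
  by rewrite E; field; exact: evy_neq0.
have hq j : T ^+ m * ev y (qj j) = ev y (\poly_(k < size (qj j)) (qj j)`_(m + k)) +
    \sum_(k < m) iota ((qj j)`_(m - k.+1)) * T ^+ k.+1.
  pose S := (m + size (qj j))%N.
  have qE : qj j = \poly_(k < S) (qj j)`_k.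
    apply/polyP => k; rewrite coef_poly; case: ltnP => // kS.
    by rewrite nth_default // (leq_trans _ kS) // leq_addl.
  have Ty k : T ^+ k * y ^+ k = 1 by rewrite -exprMn mulVf ?y_neq0 // expr1n.
  rewrite {1}qE !ev_poly mulr_sumr big_split_ord [LHS]addrC /=; congr (_ + _).
    by apply: eq_bigr => k _; rewrite exprD mulrCA [T ^+ m * _]mulrA Ty mul1r.
  rewrite (reindex_inj rev_ord_inj) /=; apply: eq_bigr => k _.
  rewrite mulrCA; congr (_ * _).
  have -> : T ^+ m = T ^+ k.+1 * T ^+ (m - k.+1) by rewrite -exprD subnKC.
  by rewrite -mulrA Ty mulr1.
exists (fun jk : 'I_n * 'I_m => (qj jk.1)`_(m - jk.2.+1)),
  (\sum_j ev y (\poly_(k < size (qj j)) (qj j)`_(m + k)) * b j),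
  (\sum_j T ^+ m * (ev y (rj j) / ev y d) * b j); split.
- rewrite {1}hz big_split /=; congr (_ + _).
  rewrite -(pair_bigA _ (fun (j : 'I_n) (k : 'I_m) => iota (qj j)`_(m - k.+1) * (T ^+ k.+1 * b j))) /=.
  rewrite -big_split; apply: eq_bigr => j _ /=.
  rewrite hq mulrDl addrC; congr (_ + _).
  by rewrite mulr_suml; apply: eq_bigr => k _; rewrite mulrA.
- move=> O hO hy; apply: place_sum => // j _.
  by apply: placeM => //; [apply: place_ev|apply: bB].
move=> O hO hT; apply: place_sum => // j _; rewrite mulrAC.
have OT := pmax_O hT.
apply: placeM => //; first exact: bT.
pose D := (size d).-1.
have sd : (size d <= D.+1)%N by apply: leqSpred.
have sr : (size (rj j) <= D.+1)%N by apply: leq_trans sd; rewrite ltnW // ltn_modp.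
rewrite (ev_rev iota y_neq0 sd) (ev_rev iota y_neq0 sr) invfM mulrACA divff ?expf_neq0 ?y_neq0 // mul1r.
apply: placeM => //; first exact: place_ev.
have nd : ~ pmax O (ev T (revpoly D d)).
  by apply: ev_unit => //; rewrite coef_poly subn0 -/(lead_coef d) lead_coef_eq0.
by have [] := place_unit hO (place_ev hO _ OT) nd.
Qed.

(** Apply [regular_decomposition] to the powers w, w^2, ... of the function
    of [pole_among_T]: enough of them are dependent modulo the last two summands. *)
Lemma pole_only_at : exists a, ~ Oi a /\ forall O, place O -> O <> Oi -> O a.
Proof.
have [w [wi hw]] := pole_among_T.
have [J [v hv]] := regular_decomposition.
have [c /choice[beta /choice[o h]]] := choice (fun k : 'I_(#|J|.+1) => hv (w ^+ k.+1)).
have [||u [k0 u0] E] := @span_dependence _ _ iota 'I_(#|J|.+1) J c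
    (fun k => w ^+ k.+1 - beta k - o k) v.
- by rewrite card_ord.
- by move=> k; case: (h k) => {1}-> _ _; ring.
pose a := \sum_k iota (u k) * beta k.
pose P := \sum_(k < #|J|.+1) u k *: 'X^(k.+1).
have aE : a = ev w P - \sum_k iota (u k) * o k.
  apply/eqP; rewrite eq_sym -subr_eq0 -[X in _ == X]E /P ev_sum -!sumrB; apply/eqP.
  apply: eq_bigr => k _; rewrite -mul_polyC evM evC evXn; ring.
have oO O : place O -> pmax O T -> O (\sum_k iota (u k) * o k).
  move=> hO hT; apply: place_sum => // k _; apply: placeM => //; first exact: place_cst.
  by have [_ _] := h k; apply.
exists a; split=> [|O hO nO].
  move=> ai; apply: (ev_notin hOi wi (p := P)); last first.
    rewrite -(subrK (\sum_k iota (u k) * o k) (ev w P)) -aE.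
    by apply: placeD => //; apply: oO => //; exact: T_pmax.
  rewrite ltnNge; apply: contra u0 => sP.
  have : P`_k0.+1 = 0 by rewrite nth_default // (leq_trans sP).
  rewrite coef_sum (bigD1 k0) //= coefZ coefXn eqxx mulr1 big1 ?addr0 => [->//|k kk].
  by rewrite coefZ coefXn eqSS eq_sym (negPf (kk : (k : nat) != k0)) mulr0.
have [hy|hy] := pselect (O y).
  apply: place_sum => // k _; apply: placeM => //; first exact: place_cst.
  by have [_] := h k; move=> /(_ O hO hy).
have [_ hT] := notin_pmax hO hy.
rewrite aE; apply: placeB => //; last exact: oO.
by apply: place_ev => //; apply: hw.
Qed.
End PoleAtInfinity.

Theorem exists_pole_only_at Oi : is_function_field iota -> place Oi ->
  exists a, ~ Oi a /\ forall O, place O -> O <> Oi -> O a.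
Proof.
move=> [x x0 [n [b gen]]] hOi.
have [_ _ _ _ [y hy]] := hOi.
have [N hN] := exists_rank_bound gen x0 y.
exact (pole_only_at hN hOi hy).

Qed.
End Places.

(** * Growth estimates in the real field *)
Section Growth.
Variables (RR : realType) (q : nat).
Hypothesis q1 : (1 < q)%N.
Implicit Types (x y t mu C : RR).

Lemma expr_eventually_ge mu C : 1 < mu -> exists I, forall n, (I <= n)%N -> C <= mu ^+ n.
Proof.
move=> mu1.
have bern n : 1 + (mu - 1) * n%:R <= mu ^+ n.
  elim: n => [|n ih]; first by rewrite mulr0 addr0.
  rewrite exprS -natr1; apply: le_trans (ler_wpM2l _ ih); last by rewrite ltW // (lt_trans ltr01).
  rewrite -subr_ge0; have -> : mu * (1 + (mu - 1) * n%:R) - (1 + (mu - 1) * (n%:R + 1)) =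
    (mu - 1) ^+ 2 * n%:R by ring.
  by rewrite mulr_ge0 ?sqr_ge0.
have [I hI] : exists I, C / (mu - 1) <= I%:R.
  by exists (Num.truncn `|C / (mu - 1)|).+1; rewrite ltW // (le_lt_trans (ler_norm _)) // truncnS_gt.
exists I => n In; apply: le_trans (bern n).
have : C / (mu - 1) <= n%:R by rewrite (le_trans hI) // ler_nat.
by rewrite ler_pdivrMr ?subr_gt0 //; lra.
Qed.

Lemma exprq_eventually_ge mu C : 1 < mu ->
  exists I, forall n, (I <= n)%N -> C <= mu ^+ (q ^ n).
Proof.
move=> mu1; have [I hI] := expr_eventually_ge C mu1; exists I => n In.
by apply: hI; rewrite (leq_trans In) // ltnW // ltn_expl.
Qed.

Lemma expr_eventually_le mu t : 0 <= mu < 1 -> 0 < t ->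
  exists I, forall n, (I <= n)%N -> mu ^+ n <= t.
Proof.
move=> /andP[]; rewrite le_eqVlt => /orP[/eqP <- _ t0|mu0 mu1 t0].
  by exists 1%N => -[|n] // _; rewrite exprS mul0r ltW.
have [|I hI] := @expr_eventually_ge mu^-1 t^-1; first by rewrite invf_gt1.
by exists I => n /hI; rewrite exprVn lef_pV2 // posrE exprn_gt0.
Qed.

(** The hypothesis reads g_n mu^(q^n) <= C max_l g_(n-l)^(q^l), the max being over
    1 <= l <= D.  In terms of the roots h_n = g_n^(1/q^n) it says that
    h_n <= (C^(1/q^n) / mu) max_l h_(n-l).  So h is bounded (by B), and from some rank on
    every D + 1 further steps multiply the bound by a factor la < 1. *)
Lemma entire_growth (I : finType) (g : I -> nat -> RR) (mu C : RR) (D : nat) :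
  (forall i n, 0 <= g i n) -> 1 < mu ->
  (forall n M, (0 < n)%N -> 0 <= M ->
    (forall i l, (0 < l <= n)%N -> (l <= D)%N -> g i (n - l)%N ^+ (q ^ l) <= M) ->
    forall i, g i n * mu ^+ (q ^ n) <= C * M) ->
  forall t, 0 < t -> exists N, forall n, (N <= n)%N -> forall i, g i n <= t ^+ (q ^ n).
Proof.
move=> g0 mu1 rec t t0.
have mu0 : 0 < mu by rewrite (lt_trans ltr01).
have qn k n : (k <= n)%N -> (q ^ (n - k) * q ^ k = q ^ n)%N.
  by move=> kn; rewrite -expnD subnK.
have [I0 hI0] := exprq_eventually_ge C mu1.
have [B B1 hB] : exists2 B, 1 <= B & forall n i, (n < I0.+1)%N -> g i n <= B.
  exists (1 + \sum_(n < I0.+1) \sum_i g i n) => [|n i nI].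
    by rewrite lerDl; do 2! apply: sumr_ge0 => ? _.
  rewrite (bigD1 (Ordinal nI)) //= (bigD1 i) //=.
  have : 0 <= \sum_(i0 | i0 != i) g i0 n by apply: sumr_ge0.
  have : 0 <= \sum_(i0 < I0.+1 | i0 != Ordinal nI) \sum_i1 g i1 i0.
    by do 2! apply: sumr_ge0 => ? _.
  by lra.
have B0 : 0 < B by apply: lt_le_trans ltr01 B1.
have base n : forall i, g i n <= B ^+ (q ^ n).
  elim/ltn_ind: n => n ih i; have [nI|In] := ltnP n I0.+1.
    by rewrite (le_trans (hB n i nI)) // ler_eXnr // expn_gt0 ltnW.
  rewrite -(ler_pM2r (exprn_gt0 (q ^ n) mu0)).
  apply: le_trans (rec n (B ^+ (q ^ n)) _ _ _ i) _ => //.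
  - exact: leq_ltn_trans In.
  - by rewrite exprn_ge0 // ltW.
  - move=> j l /andP[l0 ln] _; rewrite -(qn l n ln) exprM.
    rewrite lerXn2r ?nnegrE ?exprn_ge0 ?(ltW B0) //.
    by apply: ih; rewrite ltn_subrL l0 (leq_trans l0 ln).
  by rewrite mulrC ler_wpM2l ?exprn_ge0 ?(ltW B0) // hI0 // ltnW.
(* la < 1 < la mu, and C <= (la mu)^(q^n) for n large *)
pose la := (1 + mu) / (2 * mu).
have la0 : 0 < la by rewrite divr_gt0 //; lra.
have la1 : la < 1 by rewrite ltr_pdivrMr; lra.
have lm : 1 < la * mu.
  have -> : la * mu = (1 + mu) / 2 by rewrite /la; field; rewrite gt_eqF.
  by rewrite ltr_pdivlMr; lra.
have [I1 hI1] := exprq_eventually_ge C lm.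
have step k : exists N, forall n, (N <= n)%N -> forall i, g i n <= (la ^+ k * B) ^+ (q ^ n).
  elim: k => [|k [N hN]]; first by exists 0%N => n _ i; rewrite mul1r.
  exists (maxn (N + D).+1 I1) => n; rewrite geq_max => /andP[Nn I1n] i.
  have lB : 0 <= la ^+ k * B by rewrite mulr_ge0 ?exprn_ge0 ?ltW.
  rewrite -(ler_pM2r (exprn_gt0 (q ^ n) mu0)).
  apply: le_trans (rec n ((la ^+ k * B) ^+ (q ^ n)) _ _ _ i) _.
  - exact: leq_ltn_trans Nn.
  - by rewrite exprn_ge0.
  - move=> j l /andP[l0 ln] lD; rewrite -(qn l n ln) exprM.
    rewrite lerXn2r ?nnegrE ?exprn_ge0 //.
    by apply: hN; lia.
  rewrite -exprMn; have -> : la ^+ k.+1 * B * mu = (la * mu) * (la ^+ k * B) by rewrite exprS; ring.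
  by rewrite [leRHS]exprMn ler_wpM2r ?exprn_ge0 // hI1.
have [|k hk] := @expr_eventually_le la (t / B) _ (divr_gt0 t0 B0); first by rewrite ltW.
have [N hN] := step k; exists N => n /hN h i; apply: le_trans (h i) _.
rewrite lerXn2r ?nnegrE ?(ltW t0) ?mulr_ge0 ?exprn_ge0 ?(ltW la0) ?(ltW B0) //.
by rewrite -ler_pdivlMr // hk.
Qed.
End Growth.

Lemma course_of_values (T : Type) (t0 : T) (step : nat -> (nat -> T) -> T) :
  (forall n f g, (forall m, (m < n)%N -> f m = g m) -> step n f = step n g) ->
  exists f, forall n, f n = step n f.
Proof.
move=> ext.
pose P := fix P n : nat -> T :=
  if n is n'.+1 then fun m => if m == n' then step n' (P n') else P n' m else fun=> t0.
have PE n m : (m < n)%N -> P n m = P m.+1 m.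
  elim: n => // n ih; rewrite ltnS leq_eqVlt => /orP[/eqP->//|mn].
  by rewrite /= (ltn_eqF mn) ih //= eqxx.
exists (fun m => P m.+1 m) => n /=; rewrite eqxx; apply: ext => m mn.
exact: PE.
Qed.

(** * Absolute values and the norm of L_infty *)
Section AbsoluteValue.
Variables (RR : realType) (k : fieldType) (v : k -> RR).
Hypothesis vP : absolute_value v.
Lemma abs_ge0 x : 0 <= v x. Proof. by case: vP. Qed.
Lemma absM x y : v (x * y) = v x * v y. Proof. by case: vP. Qed.
Lemma abs_eq0 x : (v x == 0) = (x == 0).
Proof. by case: vP => _ h _ _; apply/eqP/eqP => /h. Qed.
Lemma abs1 : v 1 = 1.
Proof.
have n0 : v 1 != 0 by rewrite abs_eq0 oner_eq0.
by apply: (mulfI n0); rewrite -absM !mulr1.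
Qed.
Lemma absX x n : v (x ^+ n) = v x ^+ n.
Proof. by elim: n => [|n ih]; rewrite ?abs1 // !exprS absM ih. Qed.
Lemma abs_expB_lt x n : 1 < v x -> (1 < n)%N -> v x ^+ n <= v (x ^+ n - x).
Proof.
move=> x1 n1; case: vP => _ _ _ /(_ (x ^+ n - x) x); rewrite subrK absX le_max.
move=> /orP[//|h]; exfalso; move: h; apply/negP; rewrite -ltNge.
by rewrite ltr_eXnr // ltW // (lt_trans ltr01).
Qed.
End AbsoluteValue.

Section Norm.
Variables (F : finFieldType) (C : pointed_curve F) (L : fieldExtType C).
Variables (RR : realType) (V : completion C RR) (W : ext_completion L V).
Local Notation q := #|F|.
Local Notation S := (tseries (constLinf W)).
Implicit Types (x y : W) (f g : S).

Lemma q_gt1 : (1 < q)%N. Proof. exact: finNzRing_gt1. Qed.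
Lemma qn_gt0 n : (0 < q ^ n)%N. Proof. by rewrite expn_gt0 ltnW ?q_gt1. Qed.

Lemma Lnorm_le x c : 0 <= c -> (forall w, absF (proj w x) <= c) -> Lnorm x <= c.
Proof. by move=> c0 h; rewrite /Lnorm; apply/bigmax_leP; split. Qed.
Lemma absF_le x w : absF (proj w x) <= Lnorm x.
Proof. by rewrite /Lnorm; apply: le_bigmax. Qed.
Lemma LnormM x y : Lnorm (x * y) <= Lnorm x * Lnorm y.
Proof.
apply: Lnorm_le => [|w]; first by rewrite mulr_ge0 ?Lnorm_ge0.
by rewrite rmorphM (absM (absFP w)) ler_pM ?absF_le ?(abs_ge0 (absFP w)).
Qed.
Lemma LnormX x n : Lnorm (x ^+ (q ^ n)) <= Lnorm x ^+ (q ^ n).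
Proof.
apply: Lnorm_le => [|w]; first by rewrite exprn_ge0 ?Lnorm_ge0.
by rewrite rmorphXn (absX (absFP w)) lerXn2r ?nnegrE ?Lnorm_ge0 ?(abs_ge0 (absFP w)) ?absF_le.
Qed.
Lemma Lnorm_sum c I (r : seq I) (P : pred I) (h : I -> W) : 0 <= c ->
  (forall i, P i -> Lnorm (h i) <= c) -> Lnorm (\sum_(i <- r | P i) h i) <= c.
Proof.
move=> c0 hc; elim/big_ind: _ => // [|x y hx hy]; first by rewrite Lnorm0.
by rewrite (le_trans (LnormD _ _)) // ge_max hx.
Qed.
(** The norm is only submultiplicative on L_infty, but a scalar of K_infty has the
    same absolute value in all the factors. *)
Lemma Lnorm_scalar (a : V) x : absK a * Lnorm x <= Lnorm (a%:A * x).
Proof.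
have a0 := abs_ge0 (absKP V) a.
rewrite [in X in X <= _]/Lnorm; elim/big_ind: _ => [|u v hu hv|w _].
- by rewrite mulr0 Lnorm_ge0.
- by case: (leP u v).
apply: le_trans (absF_le _ w).
by rewrite mulr_algl linearZ /= -mulr_algl (absM (absFP w)) absF_ext.
Qed.

Lemma decaysP r f : 0 <= r -> decays r f <->
  forall e : RR, 0 < e -> exists N, forall n, (N <= n)%N ->
    Lnorm (tcoef f n) * r ^+ (q ^ n) <= e.
Proof.
move=> r0; rewrite /decays.
have nn n : `|Lnorm (tcoef f n) * r ^+ (q ^ n)| = Lnorm (tcoef f n) * r ^+ (q ^ n).
  by rewrite ger0_norm // mulr_ge0 ?exprn_ge0 ?Lnorm_ge0.
split=> [/cvgr0Pnorm_le h e e0|h].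
  by have [N _ hN] := h e e0; exists N => n /hN /=; rewrite nn.
by apply/cvgr0Pnorm_le => e /h[N hN]; exists N => // n /hN /=; rewrite nn.
Qed.

Lemma tateP f : tate W f <-> forall e : RR, 0 < e -> exists N, forall n, (N <= n)%N ->
  Lnorm (tcoef f n) <= e.
Proof.
apply: iff_trans (decaysP f ler01) _.
by split=> h e /h[N hN]; exists N => n /hN; rewrite expr1n mulr1.
Qed.

(** Boundedness at the radius s^2 implies convergence to 0 at the radius s. *)
Lemma overconv_bound (s c : RR) N f : 1 < s ->
  (forall n, (N <= n)%N -> Lnorm (tcoef f n) * (s ^+ 2) ^+ (q ^ n) <= c) -> dagger W f.
Proof.
move=> s1 h; have s0 : 0 < s by rewrite (lt_trans ltr01).
exists s => //; apply/decaysP => [|e e0]; first exact: ltW.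
have [I hI] := exprq_eventually_ge q_gt1 (c / e) s1.
exists (maxn N I) => n; rewrite geq_max => /andP[Nn In].
rewrite -(ler_pM2r (exprn_gt0 (q ^ n) s0)) -mulrA -expr2 exprAC.
apply: le_trans (h n Nn) _; rewrite mulrC -ler_pdivrMr //; exact: hI.
Qed.
End Norm.

Lemma expr_near_1 (RR : realType) (r : RR) m : 1 < r ->
  exists rho, [/\ 1 < rho, rho <= r & rho ^+ m <= 2].
Proof.
move=> r1; pose de := Num.min (r - 1) (2 ^+ m)^-1.
have p0 : 0 < (2 ^+ m)^-1 :> RR by rewrite invr_gt0 exprn_gt0.
have p1 : (2 ^+ m)^-1 <= 1 :> RR by rewrite invf_le1 ?exprn_gt0 // exprn_ege1 // ler1n.
have d0 : 0 < de by rewrite lt_min subr_gt0 r1.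
have dr : de <= r - 1 by rewrite ge_min lexx.
have dm : de <= (2 ^+ m)^-1 by rewrite ge_min lexx orbT.
exists (1 + de); split; try lra.
have h k : (1 + de) ^+ k <= 1 + (2 ^+ k - 1) * de.
  elim: k => [|k ih]; first by rewrite !expr0 subrr mul0r addr0.
  rewrite exprS; apply: le_trans (ler_wpM2l _ ih) _; first by lra.
  have : 1 <= 2 ^+ k :> RR by rewrite exprn_ege1 // ler1n.
  rewrite [2 ^+ k.+1]exprS; move: (2 ^+ k) => A A1; rewrite -subr_ge0.
  have -> : 1 + (2 * A - 1) * de - (1 + de) * (1 + (A - 1) * de) = (A - 1) * (1 - de) * de by ring.
  by rewrite !mulr_ge0 //; lra.
apply: le_trans (h m) _.
have : 2 ^+ m * de <= 1 by rewrite mulrC -ler_pdivlMr ?exprn_gt0 // mul1r.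
lra.
Qed.

Lemma expr_le_self (RR : realType) (x c : RR) n : 0 <= x -> x <= c -> c <= 1 -> (1 < n)%N ->
  x ^+ n <= c * x.
Proof.
move=> x0 xc c1; case: n => [|[|n]] // _; rewrite exprS exprS.
have x1 : x <= 1 by rewrite (le_trans xc).
have : x ^+ n <= 1 by rewrite exprn_ile1.
have : 0 <= x ^+ n by rewrite exprn_ge0.
move: (x ^+ n) => u u0 u1.
apply: le_trans (_ : x * x <= _); last by rewrite ler_wpM2r.
by rewrite ler_wpM2l // -[leRHS]mulr1 ler_wpM2l.
Qed.

Lemma leq_of_ltn_sub (a b k n : nat) : (n - k < a)%N -> (a + b <= n)%N -> (b <= k)%N.
Proof. lia. Qed.

(** * The equation z = exp y in convergent and overconvergent series *)
Section Solve.
Variables (F : finFieldType) (C : pointed_curve F) (L : fieldExtType C).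
Variables (RR : realType) (V : completion C RR) (W : ext_completion L V).
Local Notation q := #|F|.
Local Notation S := (tseries (constLinf W)).
Local Notation nrm := (@Lnorm _ _ _ _ _ W).

Lemma tset_add (X : tsubmod (tstau (constLinf W))) f g : X f -> X g -> X (f + g).
Proof.
move=> hf hg; rewrite -[g]opprK; apply: tsetB => //.
by rewrite -sub0r; apply: tsetB => //; exact: tset0.
Qed.
Lemma tset_sum (X : tsubmod (tstau (constLinf W))) I (r : seq I) (P : pred I) (f : I -> S) :
  (forall i, P i -> X (f i)) -> X (\sum_(i <- r | P i) f i).
Proof. by move=> h; elim/big_ind: _ => //; [exact: tset0|exact: tset_add]. Qed.

Lemma decays_mulr r (P f : S) : 0 <= r -> (exists D, forall n, (D <= n)%N -> tcoef P n = 0) ->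
  decays r f -> decays r (P * f).
Proof.
move=> r0 [D hD] /(decaysP f r0) hf; apply/(decaysP _ r0) => e e0.
pose B := 1 + \sum_(l < D) nrm (tcoef P l).
have B1 : 1 <= B by rewrite lerDl sumr_ge0 // => l _; exact: Lnorm_ge0.
have B0 : 0 < B by apply: lt_le_trans ltr01 B1.
have hB l : nrm (tcoef P l) <= B.
  have [lD|/hD ->] := ltnP l D; last by rewrite Lnorm0 ltW.
  rewrite /B (bigD1 (Ordinal lD)) //= addrCA lerDl addr_ge0 // sumr_ge0 // => i _.
  exact: Lnorm_ge0.
pose de := Num.min 1 (e / B).
have de0 : 0 < de by rewrite lt_min ltr01 divr_gt0.
have de1 : de <= 1 by rewrite ge_min lexx.
have deB : de <= e / B by rewrite ge_min lexx orbT.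
have [N hN] := hf de de0; exists (N + D)%N => n Nn.
have [->|rn0] := eqVneq (r ^+ (q ^ n)) 0; first by rewrite mulr0 ltW.
have rn : 0 < r ^+ (q ^ n) by rewrite lt_neqAle eq_sym rn0 exprn_ge0.
rewrite -ler_pdivlMr // tcoefM; apply: Lnorm_sum => [|l _].
  by rewrite divr_ge0 // ltW.
have [Dl|lD] := leqP D l; first by rewrite hD // mul0r Lnorm0 divr_ge0 // ltW.
rewrite ler_pdivlMr //.
have ln : (l <= n)%N by rewrite -ltnS ltn_ord.
have -> : (q ^ n = q ^ (n - l) * q ^ l)%N by rewrite -expnD subnK.
apply: le_trans (ler_wpM2r _ (LnormM _ _)) _; first by rewrite exprn_ge0.
apply: le_trans (ler_wpM2r _ (ler_wpM2l (Lnorm_ge0 _) (LnormX _ _))) _; first by rewrite exprn_ge0.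
rewrite exprM -mulrA -exprMn.
have Nl : (N <= n - l)%N by rewrite leq_subRL // addnC (leq_trans _ Nn) // leq_add2l ltnW.
have x0 : 0 <= nrm (tcoef f (n - l)) * r ^+ (q ^ (n - l)) by rewrite mulr_ge0 ?Lnorm_ge0 ?exprn_ge0.
have xl : (nrm (tcoef f (n - l)) * r ^+ (q ^ (n - l))) ^+ (q ^ l) <= de.
  have h := hN _ Nl; apply: le_trans h; rewrite -[leRHS]expr1.
  by apply: ler_wiXn2l => //; [rewrite (le_trans (hN _ Nl))|exact: qn_gt0].
apply: le_trans (_ : B * de <= _).
  by apply: ler_pM => //; [exact: Lnorm_ge0|exact: exprn_ge0].
by rewrite mulrC -ler_pdivlMr.
Qed.

Lemma tate_mulr (P f : S) : (exists D, forall n, (D <= n)%N -> tcoef P n = 0) ->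
  tate W f -> tate W (P * f).
Proof. exact: decays_mulr. Qed.
Lemma dagger_mulr (P f : S) : (exists D, forall n, (D <= n)%N -> tcoef P n = 0) ->
  dagger W f -> dagger W (P * f).
Proof.
move=> hP [r r1 hf]; exists r => //; apply: decays_mulr => //.
by rewrite ltW // (lt_trans ltr01).
Qed.
Lemma dagger_poly (f : S) : (exists D, forall n, (D <= n)%N -> tcoef f n = 0) -> dagger W f.
Proof.
move=> [D hD]; apply: (@overconv_bound _ _ _ _ _ _ 2 0 D); first by rewrite ltr1n.
by move=> n /hD ->; rewrite Lnorm0 mul0r.
Qed.

Variables (d : nat) (E : 'I_d -> 'I_d -> S).
Hypothesis E0 : forall i j, tcoef (E i j) 0 = (i == j)%:R.
Hypothesis Eent : forall t : RR, 0 < t ->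
  exists N, forall n, (N <= n)%N -> forall i j, nrm (tcoef (E i j) n) <= t ^+ (q ^ n).

(** The part of exp y that involves the coefficients of exp other than the
    constant one; it depends only on the earlier coefficients of y. *)
Definition rest (y : 'I_d -> nat -> W) i n : W := \sum_j \sum_(k < n)
  tcoef (E i j) k.+1 * y j (n - k.+1)%N ^+ (q ^ k.+1).

Lemma coef_Ey (y : 'I_d -> S) i n :
  tcoef (\sum_j E i j * y j) n = tcoef (y i) n + rest (fun j => tcoef (y j)) i n.
Proof.
have -> : tcoef (\sum_j E i j * y j) n = \sum_j tcoef (E i j * y j) n.
  by apply: (big_morph (fun f : S => tcoef f n)); [|exact: tcoef0].
under eq_bigr => j _ do rewrite tcoefM big_ord_recl subn0 expn0 expr1 E0.
rewrite big_split /=; congr (_ + _).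
rewrite (bigD1 i) //= eqxx mul1r big1 ?addr0 // => j ji.
by rewrite eq_sym (negPf ji) mul0r.
Qed.

Lemma rest_le (y : 'I_d -> nat -> W) i n c : 0 <= c ->
  (forall j k, (0 < k <= n)%N -> nrm (tcoef (E i j) k) * nrm (y j (n - k)%N) ^+ (q ^ k) <= c) ->
  nrm (rest y i n) <= c.
Proof.
move=> c0 h; do 2! (apply: Lnorm_sum => // ? _).
apply: le_trans (LnormM _ _) _.
apply: le_trans (ler_wpM2l (Lnorm_ge0 _) (LnormX _ _)) _.
by apply: h; rewrite ltn_ord.
Qed.

(** For such a c, an element x of norm at most c satisfies
    |e_k x^(q^k)| <= |x| / 2 for all k >= 1. *)
Lemma E_bound : exists2 c : RR, 0 < c & c <= 1 /\ forall i j k, nrm (tcoef (E i j) k) * c <= 1 / 2.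
Proof.
have [N hN] := Eent ltr01.
pose B := 1 + \sum_(k < N) \sum_i \sum_j nrm (tcoef (E i j) k).
have S0 : 0 <= \sum_(k < N) \sum_i \sum_j nrm (tcoef (E i j) k).
  by do 3! (apply: sumr_ge0 => ? _); exact: Lnorm_ge0.
have B0 : 1 <= B by rewrite lerDl.
have hB i j k : nrm (tcoef (E i j) k) <= B.
  have [kN|/hN/(_ i j)] := ltnP k N; last by rewrite expr1n => h; exact: le_trans B0.
  rewrite /B (bigD1 (Ordinal kN)) //= (bigD1 i) //= (bigD1 j) //=.
  set s1 := \sum_(_ < d | _ != j) _; set s2 := \sum_(_ < d | _ != i) _; set s3 := \sum_(_ < N | _) _.
  have : 0 <= s1 by apply: sumr_ge0 => ? _; exact: Lnorm_ge0.
  have : 0 <= s2 by do 2! (apply: sumr_ge0 => ? _); exact: Lnorm_ge0.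
  have : 0 <= s3 by do 3! (apply: sumr_ge0 => ? _); exact: Lnorm_ge0.
  lra.
exists (1 / (2 * B)); first by rewrite divr_gt0 //; lra.
split; first by rewrite ler_pdivrMr; lra.
move=> i j k; apply: le_trans (ler_wpM2r _ (hB i j k)) _.
  by rewrite divr_ge0 //; lra.
have -> : B * (1 / (2 * B)) = 1 / 2 by field; lra.
by [].
Qed.

Lemma uniform_index (P : 'I_d -> nat -> Prop) :
  (forall j, exists N, forall n, (N <= n)%N -> P j n) ->
  exists N, forall n, (N <= n)%N -> forall j, P j n.
Proof.
move=> /choice[N hN]; exists (\max_j N j)%N => n Nn j; apply: hN.
by apply: leq_trans Nn; exact: (leq_bigmax j).
Qed.

Lemma uniform_tate (y : 'I_d -> S) : (forall j, tate W (y j)) ->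
  forall e : RR, 0 < e -> exists N, forall n, (N <= n)%N -> forall j, nrm (tcoef (y j) n) <= e.
Proof. by move=> hy e e0; apply: uniform_index => j; have /tateP := hy j; apply. Qed.

Lemma uniform_dagger (z : 'I_d -> S) : (forall j, dagger W (z j)) ->
  exists2 r : RR, 1 < r & forall j, decays r (z j).
Proof.
move=> hz; have /choice[r hr] j : exists r : RR, 1 < r /\ decays r (z j).
  by have [r] := hz j; exists r.
exists (\big[Num.min/2]_j r j) => [|j].
  by elim/big_ind: _ => [|x y hx hy|j _]; [rewrite ltr1n|rewrite lt_min hx|case: (hr j)].
have [_] := hr j; apply: decays_le; last exact: bigmin_le.
elim/big_ind: _ => [//|x y hx hy|i _]; first by rewrite le_min hx.
by rewrite ltW // (lt_trans ltr01) //; case: (hr i).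
Qed.

Lemma overconv_of_image (y : 'I_d -> S) : (forall j, tate W (y j)) ->
  (forall i, dagger W (\sum_j E i j * y j)) -> forall j, dagger W (y j).
Proof.
move=> hy hz; have [c c0 [c1 hc]] := E_bound.
have [r r1 hr] := uniform_dagger hz.
have r0 : 0 < r by apply: lt_trans r1.
have [N1 hN1] := uniform_tate hy (divr_gt0 c0 (ltr0Sn RR 1)).
pose B := 1 + \sum_(n < N1) \sum_j nrm (tcoef (y j) n).
have B1 : 1 <= B by rewrite lerDl; do 2! (apply: sumr_ge0 => ? _); exact: Lnorm_ge0.
have hB j n : nrm (tcoef (y j) n) <= B.
  have [nN|/hN1/(_ j) h] := ltnP n N1; last by apply: le_trans h _; lra.
  rewrite /B (bigD1 (Ordinal nN)) //= (bigD1 j) //=.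
  set s1 := \sum_(_ < d | _ != j) _; set s2 := \sum_(_ < N1 | _) _.
  have : 0 <= s1 by apply: sumr_ge0 => ? _; exact: Lnorm_ge0.
  have : 0 <= s2 by do 2! (apply: sumr_ge0 => ? _); exact: Lnorm_ge0.
  lra.
(* R bounds |y_m| rho^(q^m) for m < N1, where the contraction is not available *)
pose R := B * r ^+ (q ^ N1).
have R0 : 0 < R by rewrite mulr_gt0 ?exprn_gt0 //; lra.
have [I0 hI0] := Eent (divr_gt0 c0 R0).
have [Nz hNz] : exists N, forall n, (N <= n)%N ->
    forall i, nrm (tcoef (\sum_j E i j * y j) n) * r ^+ (q ^ n) <= c.
  by apply: uniform_index => i; have /(decaysP _ (ltW r0)) := hr i; apply.
pose N2 := (N1 + I0 + Nz)%N.
(* with this rho, passing from |y_n| to |y_n| rho^(q^n) at most doubles it for n < N2 *)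
have [rho [rho1 rhor rho2]] := expr_near_1 (q ^ N2) r1.
have rho0 : 0 < rho by apply: lt_trans rho1.
have rx n : 0 < rho ^+ (q ^ n) by rewrite exprn_gt0.
have rle n : rho ^+ (q ^ n) <= r ^+ (q ^ n) by rewrite lerXn2r ?nnegrE // ltW.
have nrm0 := @Lnorm_ge0 _ _ _ _ _ W.
have key n : (N1 <= n)%N -> forall i, nrm (tcoef (y i) n) * rho ^+ (q ^ n) <= c.
  elim/ltn_ind: n => n ih Nn i; have [nN|Nn2] := ltnP n N2.
    apply: le_trans (_ : c / 2 * 2 <= c); last by rewrite divfK ?pnatr_eq0.
    apply: ler_pM => //; [exact: ltW|exact: hN1|].
    apply: le_trans rho2; apply: ler_weXn2l; first exact: ltW.
    by rewrite leq_pexp2l ?(ltnW nN) // ltnW ?q_gt1.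
  rewrite -ler_pdivlMr //.
  have -> : tcoef (y i) n = tcoef (\sum_j E i j * y j) n - rest (fun j => tcoef (y j)) i n.
    by rewrite coef_Ey addrK.
  apply: le_trans (LnormD _ _) _; rewrite LnormN ge_max; apply/andP; split.
    rewrite ler_pdivlMr //; apply: le_trans (hNz n _ i); last by apply: leq_trans Nn2; exact: leq_addl.
    by rewrite ler_wpM2l.
  apply: rest_le => [|j k /andP[k0 kn]]; first by rewrite divr_ge0 // ltW.
  rewrite ler_pdivlMr //.
  have -> : (q ^ n = q ^ (n - k) * q ^ k)%N by rewrite -expnD subnK.
  rewrite exprM -mulrA -exprMn; set x := _ * rho ^+ _.
  have x0 : 0 <= x by rewrite mulr_ge0 // ltW.
  have [Nnk|nkN] := leqP N1 (n - k).
    have xc : x <= c by apply: ih => //; rewrite ltn_subrL k0 (leq_trans k0).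
    apply: le_trans (ler_wpM2l (nrm0 _) (expr_le_self x0 xc c1 _)) _.
      by rewrite -(exp1n k) ltn_exp2r // q_gt1.
    rewrite mulrA; apply: le_trans (ler_wpM2r x0 (hc i j k)) _; lra.
  have xR : x <= R.
    rewrite /x /R; apply: ler_pM => //; first exact: ltW.
    apply: le_trans (rle _) _; apply: ler_weXn2l; first exact: ltW.
    by rewrite leq_pexp2l ?(ltnW nkN) // ltnW ?q_gt1.
  have kI : (I0 <= k)%N by apply: leq_of_ltn_sub nkN _; apply: leq_trans Nn2; exact: leq_addr.
  apply: le_trans (_ : (c / R) ^+ (q ^ k) * R ^+ (q ^ k) <= _).
    apply: ler_pM => //; [exact: exprn_ge0|exact: hI0|].
    by rewrite lerXn2r ?nnegrE // ltW.
  rewrite -exprMn divfK ?gt_eqF // -[leRHS]expr1.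
  by apply: ler_wiXn2l => //; [exact: ltW|exact: qn_gt0].
move=> j; apply: (@overconv_bound _ _ _ _ _ _ (Num.sqrt rho) c N1).
  by rewrite -(ltr_sqrt 1 rho0) sqrtr1 in rho1.
by move=> n Nn; rewrite sqr_sqrtr ?(ltW rho0) //; exact: key.
Qed.

Lemma image_add_dagger (z : 'I_d -> S) : (forall i, tate W (z i)) ->
  exists y : 'I_d -> S, (forall j, tate W (y j)) /\
    forall i, dagger W (z i - \sum_j E i j * y j).
Proof.
move=> hz; have [c c0 [c1 hc]] := E_bound.
have [N0 hN0] := uniform_tate hz c0.
pose zt i n := if (N0 <= n)%N then tcoef (z i) n else 0.
have nrm0 := @Lnorm_ge0 _ _ _ _ _ W.
have [|Y hY] := @course_of_values ('I_d -> W) (fun=> 0)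
    (fun n f i => zt i n - rest (fun j m => f m j) i n).
  move=> n f g fg; apply/funext => i; congr (_ - _).
  apply: eq_bigr => j _; apply: eq_bigr => k _; rewrite fg //.
  by rewrite ltn_subrL /= (leq_ltn_trans _ (ltn_ord k)).
have hYi n i : Y n i = zt i n - rest (fun j m => Y m j) i n by rewrite {1}hY.
have Yc n : forall i, nrm (Y n i) <= c.
  elim/ltn_ind: n => n ih i; rewrite hYi.
  apply: le_trans (LnormD _ _) _; rewrite LnormN ge_max; apply/andP; split.
    by rewrite /zt; case: ifP => [/hN0//|_]; rewrite Lnorm0 ltW.
  apply: rest_le => [|j k /andP[k0 kn]]; first exact: ltW.
  have xc : nrm (Y (n - k)%N j) <= c by apply: ih; rewrite ltn_subrL k0 (leq_trans k0).
  apply: le_trans (ler_wpM2l (nrm0 _) (expr_le_self (nrm0 _) xc c1 _)) _.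
    by rewrite -(exp1n k) ltn_exp2r // q_gt1.
  rewrite mulrA; apply: le_trans (ler_wpM2r (nrm0 _) (hc i j k)) _.
  by have := nrm0 (Y (n - k)%N j); lra.
(* the contraction halves any eventual bound on Y *)
have half e : 0 < e -> e <= c ->
    (exists N, forall n, (N <= n)%N -> forall i, nrm (Y n i) <= e) ->
    exists N, forall n, (N <= n)%N -> forall i, nrm (Y n i) <= e / 2.
  move=> e0 ec [N hN]; have e20 : 0 < e / 2 by lra.
  have [N1 hN1] := uniform_tate hz e20.
  have [I0 hI0] := Eent e20.
  exists (N + N1 + I0)%N => n Nn i; rewrite hYi.
  apply: le_trans (LnormD _ _) _; rewrite LnormN ge_max; apply/andP; split.
    rewrite /zt; case: ifP => [_|_]; last by rewrite Lnorm0 ltW.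
    by apply: hN1; lia.
  apply: rest_le => [|j k /andP[k0 kn]]; first exact: ltW.
  have [Nnk|nkN] := leqP N (n - k).
    have xc := Yc (n - k)%N j.
    apply: le_trans (ler_wpM2l (nrm0 _) (expr_le_self (nrm0 _) xc c1 _)) _.
      by rewrite -(exp1n k) ltn_exp2r // q_gt1.
    rewrite mulrA; apply: le_trans (ler_wpM2r (nrm0 _) (hc i j k)) _.
    by have := hN _ Nnk j; lra.
  apply: le_trans (_ : e / 2 * 1 <= _); last by rewrite mulr1.
  apply: ler_pM => //; first exact: exprn_ge0.
    apply: le_trans (hI0 k _ i j) _; first by lia.
    rewrite -[leRHS]expr1; apply: ler_wiXn2l; [exact: ltW|lra|exact: qn_gt0].
  by apply: exprn_ile1 => //; exact: le_trans (Yc _ _) c1.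
have Ylim k : exists N, forall n, (N <= n)%N -> forall i, nrm (Y n i) <= (1 / 2) ^+ k * c.
  elim: k => [|k ih]; first by exists 0%N => n _ i; rewrite expr0 mul1r.
  have hk : 0 < (1 / 2) ^+ k :> RR by rewrite exprn_gt0 // divr_gt0.
  have [||N hN] := half _ _ _ ih.
  - by rewrite mulr_gt0.
  - by rewrite ler_piMl ?(ltW c0) // exprn_ile1 //; lra.
  exists N => n /hN h i; apply: le_trans (h i) _; rewrite exprS; lra.
exists (fun j => TSeries _ (fun n => Y n j)); split=> [j|i].
  apply/tateP => e e0.
  have h2 : 0 <= (1 / 2 : RR) < 1 by apply/andP; split; lra.
  have [K hK] := expr_eventually_le h2 e0.
  have [N hN] := Ylim K; exists N => n /hN /(_ j) h; apply: le_trans h _.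
  apply: le_trans (hK K (leqnn _)); rewrite ler_piMr // exprn_ge0 //; lra.
apply: dagger_poly; exists N0 => n Nn.
rewrite tcoefB coef_Ey /= hYi {1}/zt Nn.
by rewrite subrK subrr.
Qed.
End Solve.

(** In characteristic p, (B - c)^(p^n) = B^(p^n) - c^(p^n) as B commutes with
    scalars, and p^n >= n. *)
Lemma nilpotent_sub_scalar (k : fieldType) p d (B : 'M[k]_d) (c : k) n :
  p \in [pchar k] -> (B - c%:M) ^+ n = 0 -> B ^+ (p ^ n) = (c ^+ (p ^ n))%:M.
Proof.
case: d B => [|d] B pk nil; first by apply/matrixP => -[].
have pM : p \in [pchar 'M[k]_d.+1] by rewrite (rmorph_pchar (@scalar_mx k d.+1)).
have cBc m : GRing.comm (B ^+ m) (c ^+ m)%:M by exact: comm_mx_scalar.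
have H m : (B - c%:M) ^+ (p ^ m) = B ^+ (p ^ m) - (c ^+ (p ^ m))%:M.
  elim: m => [|m ih]; first by rewrite expn0 !expr1.
  rewrite expnS mulnC !exprM ih.
  have := pFrobenius_autB_comm pM (cBc (p ^ m)%N); rewrite !pFrobenius_autE => ->.
  by rewrite -rmorphXn.
have : (B - c%:M) ^+ (p ^ n) = 0.
  rewrite -[(p ^ n)%N](@subnK n) ?exprD ?nil ?mulr0 //.
  by rewrite ltnW // ltn_expl // prime_gt1 // (pcharf_prime pk).
by rewrite H => /eqP; rewrite subr_eq0 => /eqP.
Qed.

(** * Coordinates on Lie(M) and the scalar case of dphi *)
Section Coordinates.
Variables (F : finFieldType) (C : pointed_curve F) (L : fieldExtType C).
Variables (M : tmodule L) (e : exponential M).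
Local Notation A := (coord_ring C).
Local Notation ML := (ML M).
Local Notation d := (erank e).
Implicit Types (a b : A) (m : M).
Local Notation pure := (tpure (tpoly_ext L) (V := M)).

Lemma pureZ P (m : M) : pure 1 (P *: m) = tpoly_ext L P *: pure 1 m.
Proof.
have [_ _ b3] := tpure_balanced (tpoly_ext L) M.
by rewrite -b3 mul1r -[tpoly_ext L P in LHS]mulr1 -tscale_pure.
Qed.
Lemma pureD (m m' : M) : pure 1 (m + m') = pure 1 m + pure 1 m'.
Proof. by have [_ b2 _] := tpure_balanced (tpoly_ext L) M; rewrite b2. Qed.
Lemma pure1 P (m : M) : pure P m = P *: pure 1 m.
Proof. by rewrite tscale_pure mulr1. Qed.

Lemma ML_act_scale a P (x : ML) : ML_act a (P *: x) = P *: ML_act a x.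
Proof.
move: x; apply: MLext => [x y|x y|P' m].
- by rewrite scalerDr ML_act_add.
- by rewrite ML_act_add scalerDr.
- by rewrite tscale_pure !ML_act_pure tscale_pure.
Qed.

(** The coordinates of the image of x in L (x) Lie(M), read off in M_L: taking
    constant terms of the coordinates avoids choosing a basis of Lie(M). *)
Definition cst_coord (x : ML) : 'rV[L]_d := \row_i tpcst (ecoord e x 0 i).

Lemma cst_coordD x y : cst_coord (x + y) = cst_coord x + cst_coord y.
Proof. by apply/rowP => i; rewrite !mxE ecoordD mxE rmorphD. Qed.
Lemma cst_coordZ P x : cst_coord (P *: x) = tpcst P *: cst_coord x.
Proof. by apply/rowP => i; rewrite !mxE ecoordZ mxE rmorphM. Qed.
Lemma cst_coord0 : cst_coord 0 = 0. Proof. exact: additive0 cst_coordD. Qed.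
Lemma cst_coord_sum I (r : seq I) (f : I -> ML) :
  cst_coord (\sum_(i <- r) f i) = \sum_(i <- r) cst_coord (f i).
Proof. exact: (big_morph _ cst_coordD cst_coord0). Qed.
Lemma cst_coord_basis i : cst_coord (ebasis i) = delta_mx 0 i.
Proof. by apply/rowP => j; rewrite mxE ecoord_basis !mxE rmorph_nat. Qed.

Definition dphi a : 'M[L]_d := \matrix_(i, j) tpcst (ephi e a i j).

Lemma cst_coord_act a (x : ML) : cst_coord (ML_act a x) = cst_coord x *m dphi a.
Proof.
rewrite -{1}(ecoordK e x) (big_morph (ML_act a) (ML_act_add a) (additive0 (ML_act_add a))).
rewrite cst_coord_sum mulmx_sum_row; apply: eq_bigr => i _.
rewrite ML_act_scale ephiP cst_coordZ mxE; congr (_ *: _).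
rewrite cst_coord_sum; apply/rowP => j; rewrite summxE (bigD1 j) //= big1 => [|k kj].
  by rewrite cst_coordZ cst_coord_basis !mxE !eqxx mulr1 addr0.
by rewrite cst_coordZ cst_coord_basis !mxE [j == k]eq_sym (negPf kj) andbF mulr0.
Qed.

Definition class_coord (m : M) : 'rV[L]_d := cst_coord (pure 1 m).
Lemma class_coordD m m' : class_coord (m + m') = class_coord m + class_coord m'.
Proof. by rewrite /class_coord pureD cst_coordD. Qed.
Lemma class_coordZ P m : class_coord (P *: m) = val (tpcst P) *: class_coord m.
Proof. by rewrite /class_coord pureZ cst_coordZ. Qed.
Lemma class_coord_act a m : class_coord (tact M a m) = class_coord m *m dphi a.
Proof. by rewrite /class_coord -ML_act_pure cst_coord_act. Qed.
Lemma class_coord_tauM m : m \in @tauM_pred _ _ _ M -> class_coord m = 0.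
Proof.
move=> /asboolP[s ->].
rewrite (big_morph _ class_coordD (additive0 class_coordD)) big1 // => p _.
by rewrite !class_coordZ [tpcst (tau _)]/= scale0r scaler0.
Qed.

(** Well defined on Lie(M) because the constant terms of the coordinates vanish on
    R[tau] tau M. *)
Definition lie_coord (x : Lie M) : 'rV[L]_d := class_coord (repr (x : quot (@tauM_pred _ _ _ M))).
Lemma lie_coordE m : lie_coord (lie_class m) = class_coord m.
Proof.
have := class_coord_tauM (qrepr (@tauM_pred _ _ _ M) m).
rewrite -[X in class_coord (_ - X)]scale1r -scaleNr => h.
apply: (addIr (- class_coord m)); rewrite subrr -[RHS]h class_coordD; congr (_ + _).
by rewrite class_coordZ rmorphN rmorph1 /= scaleN1r.
Qed.
Lemma lie_coordD x y : lie_coord (x + y) = lie_coord x + lie_coord y.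
Proof.
by elim/lieW: x => x; elim/lieW: y => y; rewrite -lie_classD !lie_coordE class_coordD.
Qed.
Lemma lie_coordZ r x : lie_coord (r *: x) = val r *: lie_coord x.
Proof. by elim/lieW: x => x; rewrite -lie_classZ !lie_coordE class_coordZ. Qed.
Lemma lie_coord_act a x : lie_coord (lie_act M a x) = lie_coord x *m dphi a.
Proof. by elim/lieW: x => x; rewrite [lie_act M a _]lie_actE !lie_coordE class_coord_act. Qed.

Lemma lie_coord_span (B : 'M[L]_d) : (forall x, lie_coord x *m B = 0) -> B = 0.
Proof.
move=> h; have hc (x : ML) : cst_coord x *m B = 0.
  move: x; apply: tens_ind => [|P m x ih]; first by rewrite cst_coord0 mul0mx.
  rewrite cst_coordD mulmxDl ih addr0 pure1 cst_coordZ -scalemxAl.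
  by rewrite -/(class_coord m) -lie_coordE h scaler0.
by apply/row_matrixP => i; rewrite row0 rowE -cst_coord_basis hc.
Qed.

Lemma dphiM a b : dphi (a * b) = dphi b *m dphi a.
Proof.
apply/eqP; rewrite -subr_eq0; apply/eqP/lie_coord_span => x.
by rewrite mulmxBr mulmxA -!lie_coord_act actM subrr.
Qed.
Lemma dphi1 : dphi 1 = 1%:M.
Proof.
apply/eqP; rewrite -subr_eq0; apply/eqP/lie_coord_span => x.
by rewrite mulmxBr mulmx1 -lie_coord_act act1 subrr.
Qed.
Lemma dphiX a n : dphi (a ^+ n) = dphi a ^+ n.
Proof.
elim: n => [|n ih]; first by rewrite !expr0 dphi1.
by rewrite exprS dphiM ih exprSr.
Qed.

Lemma dphi_nilpotent a : anderson_motive M -> exists n, (dphi a - (coord_to_ext L a)%:M) ^+ n = 0.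
Proof.
move=> [_ _ /(_ a)[n hn]]; exists n; apply: lie_coord_span => x.
have -> : lie_coord x *m (dphi a - (coord_to_ext L a)%:M) ^+ n =
    lie_coord (iter n (fun y => lie_act M a y - coord_to_intcl L a *: y) x).
  elim: n {hn} => [|n ih]; first by rewrite expr0 mulmx1.
  rewrite exprSr mulmxA ih iterS; set y := iter n _ x.
  rewrite -scaleNr lie_coordD lie_coordZ lie_coord_act mulmxBr mul_mx_scalar.
  by rewrite rmorphN scaleNr.
by rewrite hn; apply: additive0 lie_coordD.
Qed.

(** A p-power of a function with a pole only at infinity: taking a power turns the
    nilpotent dphi(a) - a into 0. *)
Lemma exists_scalar_dphi : anderson_motive M -> exists a : A,
  ~ infty C (val a) /\ dphi a = (coord_to_ext L a)%:M.
Proof.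
move=> hM; have [x [nx hx]] := exists_pole_only_at (funfieldP C) (inftyP C).
have xA : x \in @coord_ring_pred F C by apply/asboolP => O; apply: hx.
pose a := CoordRing xA; have [n nil] := dphi_nilpotent a hM.
have [p p_pr pF] := finPcharP F.
have pL : p \in [pchar L] by rewrite (rmorph_pchar (constL L)).
exists (a ^+ (p ^ n)); split.
  rewrite rmorphXn /= => h; apply: nx; apply: contrapT => nx.
  have [x0 xm] := notin_pmax (inftyP C) nx.
  have pn : (0 < p ^ n)%N by rewrite expn_gt0 prime_gt0.
  apply: nx; rewrite -(prednK pn) exprSr in h.
  have := placeM (inftyP C) (placeX (inftyP C) (p ^ n).-1 (pmax_O xm)) h.
  by rewrite mulrA -exprMn mulVf // expr1n mul1r.
rewrite dphiX (nilpotent_sub_scalar pL nil); congr (_%:M).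
by rewrite (rmorphXn (coord_to_ext L)).
Qed.
End Coordinates.

Lemma tcoef_sum (F : finFieldType) (B : comNzRingType) (i : {rmorphism F -> B})
  I (r : seq I) (P : pred I) (f : I -> tseries i) n :
  tcoef (\sum_(j <- r | P j) f j) n = \sum_(j <- r | P j) tcoef (f j) n.
Proof. exact: (big_morph (fun f : tseries i => tcoef f n) (fun _ _ => erefl) (tcoef0 i n)). Qed.

Lemma tcoefMconst (F : finFieldType) (B : comNzRingType) (i : {rmorphism F -> B})
  (f : tseries i) c n : tcoef (f * tsconst i c) n = tcoef f n * c ^+ (#|F| ^ n).
Proof.
rewrite tcoefM big_ord_recr /= subnn big1 ?add0r // => k _.
have : (0 < n - k)%N by rewrite subn_gt0.
by case: (n - k)%N => // m _ /=; rewrite qexp0 mulr0.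
Qed.

(** * The exponential series is entire *)
Section Exponential.
Variables (F : finFieldType) (C : pointed_curve F) (L : fieldExtType C).
Variables (M : tmodule L) (e : exponential M).
Local Notation A := (coord_ring C).
Local Notation d := (erank e).
Local Notation q := #|F|.
Implicit Types (a : A).

(** The coefficient of tau^n in exp dphi(a) = phi(a) exp, with the term l = 0 of
    the right-hand side moved to the left. *)
Lemma exp_recursion a (i j : 'I_d) n : dphi e a = (coord_to_ext L a)%:M ->
  (coord_to_ext L a ^+ (q ^ n) - coord_to_ext L a) * tcoef (eexp e i j) n =
  \sum_k \sum_(l < n) tcoef (val (ephi e a i k)) l.+1 *
    tcoef (eexp e k j) (n - l.+1) ^+ (q ^ l.+1).
Proof.
set th := coord_to_ext L a => da.
have dE k k' : tpcst (ephi e a k k') = th *+ (k == k').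
  by have /matrixP/(_ k k') := da; rewrite !mxE.
have /matrixP/(_ i j) := eexpP e a; rewrite !mxE => /(congr1 (fun f => tcoef f n)).
rewrite !tcoef_sum (bigD1 j) // big1 => [|k kj]; last first.
  by rewrite mxE tcoefMconst dE (negPf kj) qexp0 mulr0.
rewrite mxE tcoefMconst dE eqxx mulr1n => /(etrans (esym (addr0 _))) E.
rewrite mulrBl [th ^+ _ * _]mulrC E.
under eq_bigr => k _ do rewrite mxE tcoefM big_ord_recl subn0 expn0 expr1 -/(tpcst _) dE.
rewrite big_split /= (bigD1 i) //= eqxx mulr1n big1 ?addr0 => [|k ki].
  by rewrite addrAC subrr add0r.
by rewrite eq_sym (negPf ki) mulr0n mul0r.
Qed.

Variables (RR : realType) (V : completion C RR) (W : ext_completion L V).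

Definition expW (i j : 'I_d) : tseries (constLinf W) := embS W (eexp e i j).

Lemma expW0 i j : tcoef (expW i j) 0 = (i == j)%:R.
Proof.
have /matrixP/(_ i j) := eexp_id e; rewrite !mxE /expW /= => ->.
by rewrite rmorph_nat.
Qed.

Lemma expW_entire : anderson_motive M -> forall t : RR, 0 < t ->
  exists N, forall n, (N <= n)%N -> forall i j, Lnorm (tcoef (expW i j) n) <= t ^+ (q ^ n).
Proof.
move=> hM t t0; have [a [na da]] := exists_scalar_dphi e hM.
set th := coord_to_ext L a in da.
pose mu := absK (embK V (val a)).
have mu1 : 1 < mu.
  by rewrite ltNge; apply/negP => /absK_infty.
have hP ij : exists D, forall l, (D <= l)%N -> tcoef (val (ephi e a ij.1 ij.2)) l = 0.
  by case: (ephi e a ij.1 ij.2) => P /= /asboolP.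
have [D0 hD0] := choice hP; pose D := (\max_ij D0 ij)%N.
have hD i k l : (D < l)%N -> tcoef (val (ephi e a i k)) l = 0.
  move=> Dl; apply: (hD0 (i, k)); apply: leq_trans (ltnW Dl).
  exact: (leq_bigmax (i, k)).
pose cf i k l := Lnorm (embL W (tcoef (val (ephi e a i k)) l)).
have cf0 i k l : 0 <= cf i k l by exact: Lnorm_ge0.
pose B := \sum_i \sum_k \sum_(l < D.+1) cf i k l.
have B0 : 0 <= B by do 3! (apply: sumr_ge0 => ? _).
have hB i k l : cf i k l <= B.
  have [lD|Dl] := ltnP l D.+1; last by rewrite /cf hD // rmorph0 Lnorm0.
  rewrite /B (bigD1 i) //= (bigD1 k) //= (bigD1 (Ordinal lD)) //= -!addrA lerDl.
  by rewrite !addr_ge0 // ?sumr_ge0 // => ? _; do ? (apply: sumr_ge0 => ? _).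
have gr := @entire_growth RR q (q_gt1 F) ('I_d * 'I_d)%type
  (fun ij n => Lnorm (tcoef (expW ij.1 ij.2) n)) mu B D _ mu1 _ t t0.
have [||N hN] := gr; last by exists N => n /hN h i j; exact: (h (i, j)).
  by move=> *; exact: Lnorm_ge0.
move=> n m n0 m0 h [i j] /=.
have thE : embL W (th ^+ (q ^ n) - th) = (embK V (val a ^+ (q ^ n) - val a))%:A.
  by rewrite -embL_alg /th /=; congr (embL W _); rewrite -[RHS]/(in_alg L _) rmorphB rmorphXn.
have h1 : mu ^+ (q ^ n) <= absK (embK V (val a ^+ (q ^ n) - val a)).
  rewrite rmorphB rmorphXn; apply: abs_expB_lt => //; first exact: absKP.
  by rewrite -(exp1n n) ltn_exp2r // q_gt1.
rewrite mulrC; apply: le_trans (ler_wpM2r (Lnorm_ge0 _) h1) _.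
apply: le_trans (Lnorm_scalar _ _) _.
rewrite -thE -rmorphM exp_recursion //.
rewrite rmorph_sum; apply: Lnorm_sum => [|k _]; first exact: mulr_ge0.
rewrite rmorph_sum; apply: Lnorm_sum => [|l _]; first exact: mulr_ge0.
rewrite rmorphM rmorphXn; apply: le_trans (LnormM _ _) _.
have [Dl|lD] := ltnP D l.+1.
  by rewrite hD // rmorph0 Lnorm0 mul0r mulr_ge0.
apply: ler_pM; [exact: Lnorm_ge0|exact: Lnorm_ge0|exact: hB|].
apply: le_trans (LnormX _ _) _; apply: (h (k, j)) => //.
by rewrite ltn_ord.
Qed.
End Exponential.

Lemma injective_surjective_bij (T U : Type) (f : T -> U) :
  injective f -> (forall y, exists x, f x = y) -> bijective f.
Proof.
move=> inj /choice[g gK]; exists g => // x.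
by apply: inj; rewrite gK.
Qed.

(** * Homomorphisms as vectors of series *)
Section Values.
Variables (F : finFieldType) (C : pointed_curve F) (L : fieldExtType C).
Variables (RR : realType) (V : completion C RR) (W : ext_completion L V).
Variables (M : tmodule L) (e : exponential M).
Local Notation d := (erank e).
Local Notation S := (tseries (constLinf W)).
Local Notation ML := (ML M).
Local Notation pure := (tpure (tpoly_ext L) (V := M)).
Local Notation cst c := (tsconst (constLinf W) (embL W c)).
Implicit Types (f : LieM M W) (g : EM M W) (X : tsubmod (tstau (constLinf W))).

Definition lie_val f (j : 'I_d) : S := extLieM f (ebasis j).
Definition E_val g (i : 'I_d) : S := extE g (ebasis i).

Lemma extLieM_expand f (x : ML) :
  extLieM f x = \sum_j cst (cst_coord e x 0 j) * lie_val f j.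
Proof.
rewrite -{1}(ecoordK e x) (big_morph (extLieM f) (extLieM_add f) (additive0 (extLieM_add f))).
by apply: eq_bigr => j _; rewrite extLieM_scale mxE.
Qed.
Lemma lie_class_val f m : f (lie_class m) = extLieM f (pure 1 m).
Proof. by rewrite extLieM_pure !rmorph1 mul1r. Qed.
Lemma extE_expand g (x : ML) : extE g x = \sum_j embP W (ecoord e x 0 j) * E_val g j.
Proof.
rewrite -{1}(ecoordK e x) (big_morph (extE g) (extE_add g) (additive0 (extE_add g))).
by apply: eq_bigr => j _; rewrite extE_scale.
Qed.
Lemma E_elt_val g m : g m = extE g (pure 1 m).
Proof. by rewrite extE_pure rmorph1 mul1r. Qed.

Lemma E_val_exp f i : E_val (expM W e f) i = \sum_j expW W i j * lie_val f j.
Proof. exact: extE_exp_basis. Qed.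

(** Stability under left multiplication by L_infty[tau], needed to pass from the
    values on the basis to all the values of a homomorphism. *)
Definition poly_stable X := forall P f : S,
  (exists D, forall n, (D <= n)%N -> tcoef P n = 0) -> X f -> X (P * f).

Lemma LieM_inP X f : poly_stable X -> f \in hom_in_pred X <-> forall j, X (lie_val f j).
Proof.
move=> hX; have hc c x : X x -> X (cst c * x) by apply: hX; exists 1%N => -[].
split=> [/asboolP h j|h].
  rewrite /lie_val; move: (ebasis j); apply: tens_ind => [|P m x ih].
    by rewrite (additive0 (extLieM_add f)); exact: tset0.
  by rewrite extLieM_add; apply: tset_add => //; rewrite extLieM_pure; apply: hc.
apply/asboolP; elim/lieW => m; rewrite lie_class_val extLieM_expand.
by apply: tset_sum => j _; apply: hc.
Qed.

Lemma EM_inP X g : poly_stable X -> g \in hom_in_pred X <-> forall j, X (E_val g j).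
Proof.
move=> hX; have hP P x : X x -> X (embP W P * x).
  apply: hX; case: P => P /= /asboolP[D hD]; exists D => n /hD /= ->.
  by rewrite rmorph0.
split=> [/asboolP h j|h].
  rewrite /E_val; move: (ebasis j); apply: tens_ind => [|P m x ih].
    by rewrite (additive0 (extE_add g)); exact: tset0.
  by rewrite extE_add; apply: tset_add => //; rewrite extE_pure; apply: hP.
apply/asboolP => m; rewrite E_elt_val extE_expand.
by apply: tset_sum => j _; apply: hP.
Qed.

Lemma lie_val_surj (y : 'I_d -> S) : exists f, forall j, lie_val f j = y j.
Proof.
pose fy (x : Lie M) := \sum_j cst (lie_coord e x 0 j) * y j.
have lin c u v : fy (c *: u + v) = intcl_const W c * fy u + fy v.
  rewrite /fy mulr_sumr -big_split; apply: eq_bigr => j _ /=.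
  rewrite lie_coordD lie_coordZ; move: (lie_coord e u) (lie_coord e v) => u' v'.
  rewrite !mxE !rmorphD mulrDl mulrA; congr (_ * _ + _).
  exact: (rmorphM (tsconst (constLinf W) \o embL W)).
pose f : LieM M W := Homt (lie_act M) (tstau _) lin; exists f => j.
have E (x : ML) : extLieM f x = \sum_j cst (cst_coord e x 0 j) * y j.
  move: x; apply: MLext => [x y'|x y'|P m].
  - exact: extLieM_add.
  - rewrite cst_coordD -big_split; apply: eq_bigr => i _.
    by rewrite mxE !rmorphD mulrDl.
  rewrite extLieM_pure /= /fy mulr_sumr; apply: eq_bigr => i _.
  rewrite lie_coordE pure1 cst_coordZ -/(class_coord e m); move: (class_coord e m) => u.
  rewrite mxE mulrA; congr (_ * _).
  exact/esym/(rmorphM (tsconst (constLinf W) \o embL W)).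
rewrite /lie_val E (bigD1 j) //= big1 ?addr0 => [|i ij].
  by rewrite cst_coord_basis mxE !eqxx !rmorph1 mul1r.
by rewrite cst_coord_basis mxE (negPf ij) andbF !rmorph0 mul0r.
Qed.

Hypothesis hM : anderson_motive M.

Lemma dagger_of_exp f (g : EM M W) : f \in hom_in_pred (tate W) ->
  g \in hom_in_pred (dagger W) -> (forall m, expM W e f m = g m) ->
  f \in hom_in_pred (dagger W).
Proof.
move=> ft gd efg; have E : expM W e f = g by apply/homtP.
apply/LieM_inP; first exact: dagger_mulr.
apply: (overconv_of_image (@expW0 _ _ _ _ e _ _ W) (@expW_entire _ _ _ _ e _ _ W hM)).
  by apply/LieM_inP; first exact: tate_mulr.
by move=> i; rewrite -E_val_exp E; move: i; apply/EM_inP; first exact: dagger_mulr.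
Qed.

Lemma exp_surj_mod_dagger g : g \in hom_in_pred (tate W) ->
  exists2 f, f \in hom_in_pred (tate W) & g - expM W e f \in hom_in_pred (dagger W).
Proof.
move=> gt; have hz i : tate W (E_val g i) by move: i; apply/EM_inP; first exact: tate_mulr.
have [y [yt yd]] := image_add_dagger (@expW0 _ _ _ _ e _ _ W) (@expW_entire _ _ _ _ e _ _ W hM) hz.
have [f hf] := lie_val_surj y; exists f.
  by apply/LieM_inP => [|j]; [exact: tate_mulr|rewrite hf].
apply/EM_inP => [|i]; first exact: dagger_mulr.
have := yd i; under eq_bigr => j _ do rewrite -hf.
rewrite -E_val_exp.
suff -> : E_val (g - expM W e f) i = E_val g i - E_val (expM W e f) i by [].
rewrite /E_val; move: (ebasis i); apply: MLext => [x x'|x x'|P m].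
- exact: extE_add.
- by rewrite !extE_add opprD addrACA.
- by rewrite !extE_pure -mulrBr.
Qed.

Lemma polyJ_dagger J g : g \in hom_in_pred (polyJ W J) -> g \in hom_in_pred (dagger W).
Proof.
move=> /asboolP h; apply/asboolP => m; have [P _ ->] := h m.
apply: dagger_poly; case: P => P /= /asboolP[D hD]; exists D => n /hD /= ->.
by rewrite rmorph0.
Qed.
End Values.

Theorem theorem3 (F : finFieldType) (C : pointed_curve F) (L : fieldExtType C)
    (RR : realType) (V : completion C RR) (W : ext_completion L V)
    (M : tmodule L) (e : exponential M) (J : ideal L) :
  anderson_motive M ->
  (exists x : int_closure L, J x /\ x <> 0) ->
  bijective (uM W e J) /\ bijective (hM W e J).
Proof.
move=> motM _; split; apply: injective_surjective_bij.
- move=> f g /(congr1 (fun x => hom_of (U_val x))) fg.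
  by do 2! apply: val_inj.
- move=> g; have [gt gU] : hom_of (U_val g) \in hom_in_pred (tate W) /\
      expM W e (hom_of (U_val g)) \in hom_in_pred (polyJ W J).
    by case: g => -[].
  have gd := dagger_of_exp motM gt (polyJ_dagger gU) (fun=> erefl).
  pose f : LieM_in M (dagger W) := HomIn gd.
  have fU : f \in @U_pred _ _ _ _ _ _ W e J (dagger W) by [].
  by exists (UType fU); do 2! apply: val_inj.
- move=> x1 x2 /eqP; rewrite -subr_eq0 -linearB => /eqP h.
  apply/eqP; rewrite -subr_eq0; apply/eqP; move: (x1 - x2) h => {x1 x2}.
  elim/qpiW => g; rewrite [hM _ _ _ _]h_funE => /qpiP; rewrite subr0 => /asboolP[f [k E]].
  apply/qpiP; rewrite subr0; apply/asboolP.
  have gd : hom_of g \in hom_in_pred (dagger W) by case: (g).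
  have ft : hom_of f \in hom_in_pred (tate W) by case: (f).
  have kd : hom_of k \in hom_in_pred (dagger W).
    by apply: (@polyJ_dagger _ _ _ _ _ _ _ J); case: (k).
  have E' : expM W e (hom_of f) = hom_of g - hom_of k.
    by apply/eqP; rewrite eq_sym subr_eq; apply/eqP; exact: E.
  have gkd : hom_of g - hom_of k \in hom_in_pred (dagger W) by exact: rpredB.
  have fd := dagger_of_exp motM ft gkd (fun m => congr1 (fun h : EM M W => h m) E').
  by exists (HomIn fd), k.
move=> y; elim/qpiW: y => g.
have gt : hom_of g \in hom_in_pred (tate W) by case: (g).
have [f ft fd] := exp_surj_mod_dagger e motM gt.
pose g' : EM_in M (dagger W) := HomIn fd.
exists (qpi (@H_pred _ _ _ _ _ _ W e J (dagger W)) g').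
rewrite [hM _ _ _ _]h_funE; apply/qpiP/asboolP.
exists (- HomIn ft : LieM_in M (tate W)), 0.
rewrite !linearB linear0 addr0 !linearN /=.
by rewrite addrAC subrr add0r.
Qed.
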